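(* Let $\mathbb K$ be an infinite field, $d\ge1$, $\mathbf m\in\mathbb N^d$, and let $U\subset P(d,\mathbf m)$ be a color-squarefree shifted monomial order ideal. Then the balanced squeezed complex $\Delta_{\mathrm{bal}}(U)$ and the complex $\widetilde{\Delta}$ obtained by color-shifting $\Delta_{\mathrm{bal}}(U)$ have the same $\mathbb Z$-graded Betti numbers (that is, their Stanley-Reisner ideals have the same $\mathbb Z$-graded Betti numbers).
   Context: Here $\mathbb N$ contains $0$. $P(d,\mathbf m)$ is the polynomial ring over $\mathbb K$ in variables $x_{i,j}$, $1\le i\le d$, $1\le j\le m_i$; $x_{i,j}$ has color $i$ and $\mathbb Z^d$-degree the unit vector $\mathbf e_i$. A monomial is color-squarefree if it is squarefree and divisible by at most one variable of each color. A color-squarefree monomial order ideal is a set $U$ of color-squarefree monomials of $P(d,\mathbf m)$ closed under taking divisors; throughout, it is assumed to contain $1$ and all variables of $P(d,\mathbf m)$. It is color-squarefree shifted if $x_{k,\ell}u\in U$ implies $x_{k,j}u\in U$ for all $\ell\le j\le m_k$. Balanced squeezed complex: let $V_i=\{1^{(i)},\dots,(m_i+1)^{(i)}\}$. For $u=x_{i_1,j_1}\cdots x_{i_s,j_s}$ color-squarefree with $i_1<\dots<i_s$ put $F_d(u)=\{j_1^{(i_1)},\dots,j_s^{(i_s)}\}\cup\{(m_j+1)^{(j)} : j\in[d]\setminus\{i_1,\dots,i_s\}\}$. Then $\Delta_{\mathrm{bal}}(U)$ is the simplicial complex whose facets are the sets $F_d(u)$, $u\in U$. Its Stanley-Reisner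 ideal lies in $P(d,\mathbf m+(1,\dots,1))$, with $x_{i,j}$ corresponding to the vertex $j^{(i)}$. Multigraded generic initial ideal: let $\mathbf n\in\mathbb N^d$. The group $GL_{n_1}(\mathbb K)\times\cdots\times GL_{n_d}(\mathbb K)$ acts on $P(d,\mathbf n)$ by $\mathbb Z^d$-graded algebra automorphisms, linearly on the variables of each color. Order the variables by $x_{i,j}>x_{k,\ell}$ if $i<k$, or $i=k$ and $j<\ell$, and use the induced reverse lexicographic order for initial ideals. For a $\mathbb Z^d$-graded ideal $I$ the initial ideal of $\varphi(I)$ is the same for all $\varphi$ in a product of nonempty Zariski open subsets of the groups $GL_{n_i}(\mathbb K)$; this is the multigraded generic initial ideal $\mathrm{gin}(I)$. Color-shifting: given a balanced complex $\Gamma$ with color classes of sizes $n_1,\dots,n_d$, take $\mathrm{gin}(I_\Gamma)$ of its Stanley-Reisner ideal $I_\Gamma\subseteq P(d,\mathbf n)$, and replace each minimal monomial generator $\prod_{i=1}^d x_{i,a_{i,1}}x_{i,a_{i,2}}\cdots x_{i,a_{i,r_i}}$ ($a_{i,1}\le a_{i,2}\le\dots\le a_{i,r_i}$) by its colored polarization $\prod_{i=1}^d x_{i,a_{i,1}}x_{i,a_{i,2}+1}\cdots x_{i,a_{i,r_i}+r_i-1}$. The squarefree monomial ideal generated by these monomials is by definition the Stanley-Reisner ideal of the color-shifted complex $\widetilde\Gamma$. (For $\Gamma=\Delta_{\mathrm{bal}}(U)$ take $\mathbf n=\mathbf m+(1,\dots,1)$.) *)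

(* Defs.v *)
From Stdlib Require Import ClassicalEpsilon.
From mathcomp Require Import all_boot all_order all_algebra.
From mathcomp Require Export mpoly.

Set Implicit Arguments.
Unset Strict Implicit.
Unset Printing Implicit Defensive.

Import GRing.Theory.
Local Open Scope ring_scope.

(* The ring P(d, n) is {mpoly K[\sum_i n i]}.  Its variable x_{i,j} is 'X_(vtx j)
   for j : 'I_(n i); indices are 0-based.  The ranking of the pairs (i, j) done
   by [tagnat] is lexicographic, so x_{i,j} > x_{k,l} in the order of the
   variables iff vtx j < vtx l as ordinals. *)
Section Indices.
Variables (d : nat) (n : 'I_d -> nat).

Definition nvars : nat := (\sum_i n i)%N.
Definition vtx (i : 'I_d) (j : 'I_(n i)) : 'I_nvars := tagnat.Rank i j.
Definition color (k : 'I_nvars) : 'I_d := tagnat.sig1 k.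
Definition index_in_color (k : 'I_nvars) : 'I_(n (color k)) := tagnat.sig2 k.

End Indices.

Arguments vtx {d n i} j.
Arguments color {d n} k.
Arguments index_in_color {d n} k.

Section Ideals.
Variables (K : fieldType) (N : nat).
Local Notation S := {mpoly K[N]}.

Definition ideal_gen (G : S -> Prop) (f : S) : Prop :=
  exists s : seq (S * S),
    (forall p, p \in s -> G p.2) /\ f = \sum_(p <- s) p.1 * p.2.

Definition stanley_reisner (Delta : {set 'I_N} -> Prop) : S -> Prop :=
  ideal_gen (fun f => exists2 G : {set 'I_N}, ~ Delta G & f = \prod_(k in G) 'X_k).

(* Graded reverse lexicographic order with 'X_0 > 'X_1 > ... . *)
Definition revlex_lt (u v : 'X_{1..N}) : bool :=
  (mdeg u < mdeg v)%N ||
  (mdeg u == mdeg v) &&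
  [exists k : 'I_N, (v k < u k)%N &&
     [forall l : 'I_N, (k < l)%N ==> (u l == v l)]].

Definition is_initial_monomial (f : S) (u : 'X_{1..N}) : Prop :=
  u \in msupp f /\ forall v, v \in msupp f -> v != u -> revlex_lt v u.

Definition initial_ideal (I : S -> Prop) : S -> Prop :=
  ideal_gen (fun g => exists f u,
    [/\ I f, is_initial_monomial f u & g = 'X_[u]]).

Definition minimal_monomial_generator (I : S -> Prop) (u : 'X_{1..N}) : Prop :=
  I 'X_[u] /\ forall v : 'X_{1..N}, (v <= u)%MM -> I 'X_[v] -> v = u.

(* A minimal graded free resolution
     ... -> \bigoplus_i S(- shift 1 i) -> \bigoplus_i S(- shift 0 i) -> I -> 0
   by free modules of finite rank.  Elements of free modules are row vectors and
   maps act by right multiplication. *)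
Record minimal_graded_resolution (I : S -> Prop) := MinimalGradedResolution {
  res_rank : nat -> nat;
  res_shift : forall p, 'I_(res_rank p) -> nat;
  res_aug : 'cV[S]_(res_rank 0%N);
  res_diff : forall p, 'M[S]_(res_rank p.+1, res_rank p);
  aug_homogeneous : forall i u, u \in msupp (res_aug i 0) -> mdeg u = res_shift i;
  diff_homogeneous : forall p i j u,
    u \in msupp (res_diff p i j) -> (mdeg u + res_shift j = res_shift i)%N;
  aug_image : forall f : S,
    I f <-> exists v : 'rV_(res_rank 0%N), (v *m res_aug) 0 0 = f;
  exact_aug : forall v : 'rV_(res_rank 0%N),
    v *m res_aug = 0 <-> exists w, v = w *m res_diff 0%N;
  exact_diff : forall p (v : 'rV_(res_rank p.+1)),
    v *m res_diff p = 0 <-> exists w, v = w *m res_diff p.+1;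
  minimality : forall p i j, (res_diff p i j)@_0%MM = 0
}.

(* Every homogeneous ideal has a minimal graded free resolution, and b does not
   depend on it, so [graded_betti] selects the unique value. *)
Definition is_graded_betti (I : S -> Prop) (p j b : nat) : Prop :=
  exists F : minimal_graded_resolution I,
    b = #|[set i : 'I_(res_rank F p) | res_shift i == j]|.

Definition graded_betti (I : S -> Prop) (p j : nat) : nat :=
  epsilon (inhabits 0%N) (is_graded_betti I p j).

End Ideals.

Arguments stanley_reisner K {N} Delta.

(* Open subsets of GL_n(K) in the Zariski topology. *)
Definition zariski_open (K : fieldType) (n : nat) (O : 'M[K]_n -> Prop) : Prop :=
  exists E : {mpoly K[n * n]} -> Prop,
    forall A : 'M[K]_n,
      O A <-> A \in unitmx /\ exists2 p, E p & p.@[fun k => mxvec A 0 k] != 0.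

Section Gin.
Variables (K : fieldType) (d : nat) (n : 'I_d -> nat).
Local Notation S := {mpoly K[nvars n]}.

(* x_{i,j} |-> \sum_l (phi i)_{l,j} x_{i,l} *)
Definition gl_act (phi : forall i, 'M[K]_(n i)) (f : S) : S :=
  f \mPo [tuple \sum_(l < n (color k))
                  phi (color k) l (index_in_color k) *: 'X_(vtx l)
         | k < nvars n].

Definition ideal_image (phi : forall i, 'M[K]_(n i)) (I : S -> Prop) (g : S) : Prop :=
  exists2 f, I f & g = gl_act phi f.

Definition is_gin (I J : S -> Prop) : Prop :=
  exists O : forall i, 'M[K]_(n i) -> Prop,
    [/\ forall i, zariski_open (O i),
        forall i, exists A, O i A
      & forall phi, (forall i, O i (phi i)) ->
          forall f, initial_ideal (ideal_image phi I) f <-> J f].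

(* For infinite K and a Z^d-graded ideal I such a J exists and is unique, as two
   products of nonempty open sets meet. *)
Definition gin (I : S -> Prop) : S -> Prop :=
  epsilon (inhabits (fun=> False)) (is_gin I).

(* a_{i,1} <= ... <= a_{i,r_i} for a monomial u, where i is fixed (0-based). *)
Definition color_word (u : 'X_{1..nvars n}) (i : 'I_d) : seq nat :=
  flatten [seq nseq (u (vtx j)) (nat_of_ord j) | j <- enum 'I_(n i)].

(* A relation, since the indices a_{i,t} + t - 1 have to remain at most n_i.
   With words counted from 0, the t-th entry is raised by t. *)
Definition is_colored_polarization (u v : 'X_{1..nvars n}) : Prop :=
  forall i, color_word v i =
    mkseq (fun t => nth 0%N (color_word u i) t + t)%N (size (color_word u i)).

Definition color_shifted_ideal (Gamma : {set 'I_(nvars n)} -> Prop) : S -> Prop :=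
  ideal_gen (fun g => exists u v,
    [/\ minimal_monomial_generator (gin (stanley_reisner K Gamma)) u,
        is_colored_polarization u v & g = 'X_[v]]).

(* The complex whose Stanley-Reisner ideal is the squarefree monomial ideal
   [color_shifted_ideal Gamma]. *)
Definition color_shift (Gamma : {set 'I_(nvars n)} -> Prop)
    (G : {set 'I_(nvars n)}) : Prop :=
  ~ color_shifted_ideal Gamma (\prod_(k in G) 'X_k).

End Gin.

Arguments color_shift K {d n} Gamma.

Section BalancedSqueezed.
Variables (d : nat) (m : 'I_d -> nat).

Definition color_squarefree (u : 'X_{1..nvars m}) : Prop :=
  (forall k, (u k <= 1)%N) /\
  (forall i (j l : 'I_(m i)), (0 < u (vtx j))%N -> (0 < u (vtx l))%N -> j = l).

Definition color_squarefree_order_ideal (U : 'X_{1..nvars m} -> Prop) : Prop :=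
  [/\ forall u, U u -> color_squarefree u,
      forall u v : 'X_{1..nvars m}, (v <= u)%MM -> U u -> U v,
      U 0%MM
    & forall k, U U_(k)%MM].

Definition color_squarefree_shifted (U : 'X_{1..nvars m} -> Prop) : Prop :=
  forall (k : 'I_d) (l j : 'I_(m k)) (u : 'X_{1..nvars m}), (l <= j)%N ->
    U (U_(vtx l) + u)%MM -> U (U_(vtx j) + u)%MM.

Definition msucc (i : 'I_d) : nat := (m i).+1.

Definition old_vertex (k : 'I_(nvars m)) : 'I_(nvars msucc) :=
  @vtx d msucc (color k) (widen_ord (leqnSn _) (index_in_color k)).

Definition new_vertex (i : 'I_d) : 'I_(nvars msucc) :=
  @vtx d msucc i ord_max.

Definition squeezed_facet (u : 'X_{1..nvars m}) : {set 'I_(nvars msucc)} :=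
  [set old_vertex k | k : 'I_(nvars m) & (0 < u k)%N] :|:
  [set new_vertex i | i : 'I_d & [forall j : 'I_(m i), u (vtx j) == 0%N]].

Definition balanced_squeezed (U : 'X_{1..nvars m} -> Prop)
    (G : {set 'I_(nvars msucc)}) : Prop :=
  exists2 u, U u & G \subset squeezed_facet u.

End BalancedSqueezed.

(* Main.v *)
From Stdlib Require Import ClassicalEpsilon FunctionalExtensionality PropExtensionality.
Require Import Defs.
From mathcomp Require Import all_boot all_order all_fingroup all_algebra zify.

(** Color-shifting fixes a balanced squeezed complex: the color-shifted complex
    of Delta = Delta_bal(U) is Delta itself, so the two Stanley-Reisner ideals
    coincide and nothing about resolutions has to be computed.

    The point is to identify the multigraded generic initial ideal of I_Delta.
    Each color i of P(d, m + 1) has m_i old variables and one last variable, and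
    a monomial is called standard if deleting its last variables leaves an
    element of U. The nonstandard monomials span an ideal J, and gin(I_Delta) = J
    ([gin_nonstandard]). Its minimal generators are the products x_{i,j} x_{i,l}
    of two old variables of the same color, j <= l, and the color-squarefree
    minimal nonmembers of U. Polarization turns the first kind into all the
    x_{i,j} x_{i,l+1} and leaves the second kind alone; these are exactly the
    minimal nonfaces of Delta ([color_shift_squeezed]).

    To prove in(phi I_Delta) = J, let y_{i,k} = phi x_{i,k} and let each phi_i be
    in general position ([in_general_position], a nonempty open condition).

    - J is contained in the initial ideal ([nonstandard_initial]). The products
      y_{i,a} y_{i,b}, a != b, lie in phi I_Delta, that is, the color i sees the
      coordinate points only; hence x_{i,j} x_{i,l} is congruent to a multiple of
      the last variable. If w is a color-squarefree nonmember of U, then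
      shiftedness puts into phi I_Delta every product of y_{i,k_i} with
      k_i <= w_i, and triangular elimination in each color combines these into a
      product of linear forms with initial monomial w.

    - The initial ideal is contained in J ([initial_monomial_nonstandard]). Faces
      of Delta restrict phi I_Delta to zero: sending y_{i,k} to t_i if k = k_i and
      to 0 otherwise kills phi I_Delta when k is a facet. If the initial monomial
      u were standard, with word w in U, then all facets k >= w would be
      available, and a product over the colors of linear combinations of them
      gives a functional that vanishes on phi I_Delta, is 1 at u, and is 0 at every
      smaller monomial of the same multidegree: such a monomial has, in the last
      color where it differs from u, a standard color part with a larger
      index, where triangularity applies. *)

Set Implicit Arguments.
Unset Strict Implicit.
Unset Printing Implicit Defensive.

Import GRing.Theory.
Local Open Scope ring_scope.

(** * Nonvanishing of polynomials over an infinite field *)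

Section InfiniteField.
Variable K : fieldType.
Hypothesis infinite_K : forall s : seq K, exists x : K, x \notin s.

Lemma uniq_seq_of_size k : exists2 s : seq K, uniq s & size s = k.
Proof.
elim: k => [|k [s us <-]]; first by exists [::].
by have [x xs] := infinite_K s; exists (x :: s); rewrite //= xs.
Qed.

(** A nonzero polynomial has fewer roots than its size. *)
Lemma poly_nonroot (q : {poly K}) : q != 0 -> exists x, q.[x] != 0.
Proof.
move=> q0; have [s us ss] := uniq_seq_of_size (size q).
have [/allP rs|/allPn[x _ qx]] := boolP (all (root q) s); last by exists x.
by have := max_poly_roots q0 (introT allP rs) us; rewrite ss ltnn.
Qed.

(** Viewing a polynomial as one in its last variable loses no coefficient, which is
    what makes the induction on the number of variables work. *)
Lemma muni_coef n (p : {mpoly K[n.+1]}) (u : 'X_{1..n.+1}) :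
  ((muni p)`_(u ord_max))@_[multinom u (widen_ord (leqnSn n) i) | i < n] = p@_u.
Proof.
rewrite muniE coef_sum raddf_sum /= [in RHS](mpolyE p) raddf_sum /=.
apply: eq_bigr => v _; rewrite coefZ coefXn !mcoeffZ mcoeffX.
have [->|vu] := eqVneq v u.
  by rewrite !eqxx mulr1 mcoeffZ mcoeffX eqxx.
have [eqm|_] := eqVneq (u ord_max) (v ord_max); last by rewrite mulr0 raddf0 mulr0.
rewrite mulr1 mcoeffZ mcoeffX.
case: eqP => [/mnmP E|]; last by [].
case/eqP: vu; apply/mnmP => i.
have [lt|ge] := ltnP i n.
  have := E (Ordinal lt); rewrite !mnmE.
  by congr (_ = _); congr (fun_of_multinom _ _); apply: val_inj.
have -> : i = ord_max; last by [].
by apply/val_inj/eqP; rewrite eqn_leq ge -ltnS ltn_ord.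
Qed.

Lemma meval_muni n (p : {mpoly K[n.+1]}) (x : 'I_n -> K) (y : K) :
  p.@[fun i => oapp x y (unlift ord_max i)] = (map_poly (meval x) (muni p)).[y].
Proof.
rewrite muniE raddf_sum horner_sum mevalE; apply: eq_bigr => v _.
rewrite big_ord_recr /= unlift_none /= map_polyZ hornerZ map_polyXn hornerXn.
rewrite /= mevalZ mevalX mulrA; congr (_ * _ * _); apply: eq_bigr => i _.
have -> : widen_ord (leqnSn n) i = lift ord_max i.
  by apply: val_inj; rewrite /= /bump leqNgt ltn_ord.
rewrite liftK mnmE; congr (_ ^+ (fun_of_multinom _ _)).
by apply: val_inj; rewrite /= /bump leqNgt ltn_ord.
Qed.

(** Specialize all variables but the last so that some coefficient survives, then
    avoid the finitely many roots of the resulting univariate polynomial. *)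
Lemma mpoly_nonroot n (p : {mpoly K[n]}) : p != 0 -> exists x, p.@[x] != 0.
Proof.
elim: n p => [|n IH] p p0.
  by exists (fun=> 0); move: p0; rewrite (nvar0_mpolyC p) mevalC mpolyC_eq0.
have [v] : exists v, p@_v != 0.
  by exists (mlead p); rewrite mleadc_eq0.
rewrite -muni_coef => pv.
have [x px] : exists x, ((muni p)`_(v ord_max)).@[x] != 0.
  by apply: IH; apply: contraNneq pv => ->; rewrite mcoeff0.
have [|y py] := @poly_nonroot (map_poly (meval x) (muni p)).
  apply: contraNneq px => /polyP/(_ (v ord_max)).
  by rewrite coef_map coef0 /= => ->.
by exists (fun i => oapp x y (unlift ord_max i)); rewrite meval_muni.
Qed.

End InfiniteField.

(** * Matrices in general position *)

Section Generic.

(** The principal submatrix of A on S, padded by the identity to keep the size n;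
    the determinant is the principal minor. *)
Definition principal_block (R : nzRingType) n (S : pred 'I_n) (A : 'M[R]_n) : 'M[R]_n :=
  \matrix_(a, b) if S a && S b then A a b else (a == b)%:R.

Lemma map_principal_block (R R' : nzRingType) (f : {rmorphism R -> R'}) n S (A : 'M[R]_n) :
  map_mx f (principal_block S A) = principal_block S (map_mx f A).
Proof.
by apply/matrixP => a b; rewrite !mxE; case: ifP => // _; rewrite rmorph_nat.
Qed.

Lemma principal_block1 (R : nzRingType) n (S : pred 'I_n) :
  principal_block S 1%:M = 1%:M :> 'M[R]_n.
Proof. by apply/matrixP => a b; rewrite !mxE if_same. Qed.

(** Cramer's rule on the block S: the padding forces the solution to vanish off S. *)
Lemma principal_solve (K : fieldType) n (S : pred 'I_n) (A : 'M[K]_n) j :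
  \det (principal_block S A) != 0 -> S j ->
  exists c : 'I_n -> K, (forall b, ~~ S b -> c b = 0) /\
    forall a, S a -> \sum_b A a b * c b = (a == j)%:R.
Proof.
move=> detA Sj; set T := principal_block S A.
have uT : T \in unitmx by rewrite unitmxE unitfE.
pose c b := invmx T b j.
have Tc a : \sum_b T a b * c b = (a == j)%:R.
  by have /matrixP/(_ a j) := mulmxV uT; rewrite !mxE.
have c0 b : ~~ S b -> c b = 0.
  move=> Sb; have bj : b == j = false by apply: contraNF Sb => /eqP ->.
  have := Tc b; rewrite bj (bigD1 b) //= big1 => [|a ab]; rewrite mxE (negbTE Sb) /=.
    by rewrite addr0 eqxx mul1r.
  by rewrite eq_sym (negbTE ab) mul0r.
exists c; split=> // a Sa; rewrite -Tc; apply: eq_bigr => b _.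
by rewrite mxE Sa /=; case: ifPn => // /c0 ->; rewrite !mulr0.
Qed.

(** Nonzero iff the leading principal minors of A, the trailing principal minors of
    its adjugate and the entries of the last column of the adjugate all are. The
    adjugate stands for the inverse, to have a polynomial; its transpose turns solving on the right into solving on the left. *)
Definition position_form (R : comNzRingType) n (A : 'M[R]_n.+1) : R :=
  (\prod_(j < n.+1) \det (principal_block (fun a : 'I_n.+1 => a <= j)%N A)) *
  (\prod_(j < n.+1) \det (principal_block (fun a : 'I_n.+1 => j <= a)%N (\adj A)^T)) *
  \prod_(k < n.+1) (\adj A) k ord_max.

Lemma map_position_form (R R' : comNzRingType) (f : {rmorphism R -> R'}) n (A : 'M[R]_n.+1) :
  f (position_form A) = position_form (map_mx f A).
Proof.
rewrite /position_form !rmorphM !rmorph_prod -map_mx_adj.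
congr (_ * _); first congr (_ * _).
- by apply: eq_bigr => j _; rewrite -map_principal_block det_map_mx.
- by apply: eq_bigr => j _; rewrite map_trmx -map_principal_block det_map_mx.
- by apply: eq_bigr => j _; rewrite [RHS]mxE.
Qed.

Variable K : fieldType.

(** Evaluating the polynomial obtained from this matrix at the entries of A is
    the same as substituting A, so polynomial conditions on matrices can be written with
    determinants and adjugates. *)
Definition generic_mx n : 'M[{mpoly K[n * n]}]_n := \matrix_(i, j) 'X_(mxvec_index i j).

Lemma meval_generic_mx n (A : 'M[K]_n) :
  map_mx (meval (fun k => mxvec A 0 k)) (generic_mx n) = A.
Proof. by apply/matrixP => i j; rewrite !mxE mevalXU mxvecE. Qed.

Definition position_poly n : {mpoly K[n.+1 * n.+1]} := position_form (generic_mx n.+1).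

Lemma meval_position_poly n (A : 'M[K]_n.+1) :
  (position_poly n).@[fun k => mxvec A 0 k] = position_form A.
Proof. by rewrite map_position_form meval_generic_mx. Qed.

Lemma adj1 n : \adj (1%:M : 'M[K]_n) = 1%:M.
Proof. by rewrite -[LHS]mul1mx mul_mx_adj det1. Qed.

Lemma meval_neq0 k (p : {mpoly K[k]}) x : p.@[x] != 0 -> p != 0.
Proof. by apply: contraNneq => ->; rewrite meval0. Qed.

(** In an integral domain it is enough that each factor is nonzero somewhere: at the
    identity for the minors, at a transposition for an entry of the adjugate. *)
Lemma position_poly_neq0 n : position_poly n != 0.
Proof.
have at1 := @meval_generic_mx n.+1 1%:M.
rewrite !mulf_eq0 !negb_or; apply/andP; split; first (apply/andP; split).
- apply/prodf_neq0 => j _; apply: (@meval_neq0 _ _ (fun k => mxvec 1%:M 0 k)).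
  by rewrite -det_map_mx map_principal_block at1 principal_block1 det1 oner_neq0.
- apply/prodf_neq0 => j _; apply: (@meval_neq0 _ _ (fun k => mxvec 1%:M 0 k)).
  rewrite -det_map_mx map_principal_block -map_trmx map_mx_adj at1 adj1 trmx1.
  by rewrite principal_block1 det1 oner_neq0.
- apply/prodf_neq0 => k _.
  pose T : 'M[K]_n.+1 := tperm_mx k ord_max.
  apply: (@meval_neq0 _ _ (fun k => mxvec T 0 k)).
  have -> : meval (fun k => mxvec T 0 k) ((\adj (generic_mx n.+1)) k ord_max) =
            (map_mx (meval (fun k => mxvec T 0 k)) (\adj (generic_mx n.+1))) k ord_max.
    by rewrite [RHS]mxE.
  rewrite map_mx_adj meval_generic_mx.
  have TT : T *m T = 1%:M by rewrite -perm_mxM tperm2 perm_mx1.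
  have -> : \adj T = \det T *: T.
    by rewrite -[LHS]mul1mx -TT -mulmxA mul_mx_adj mul_mx_scalar.
  rewrite mxE /T /tperm_mx /perm_mx !mxE tpermL eqxx mulr1.
  by rewrite det_perm signr_eq0.
Qed.

(** The elimination facts that are used below. The second clause is one half of an
    LU decomposition: combinations of the first columns of A reach the j-th unit
    vector modulo later coordinates. The third is its counterpart for the last rows of the
    inverse. *)
Definition in_general_position n (A : 'M[K]_n.+1) : Prop :=
  [/\ A \in unitmx,
      forall j : 'I_n.+1, exists c : 'I_n.+1 -> K,
        (forall b : 'I_n.+1, (j < b)%N -> c b = 0) /\
        forall a : 'I_n.+1, (a <= j)%N -> \sum_b A a b * c b = (a == j)%:R,
      forall j : 'I_n.+1, exists c : 'I_n.+1 -> K,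
        (forall b : 'I_n.+1, (b < j)%N -> c b = 0) /\
        forall a : 'I_n.+1, (j <= a)%N -> \sum_b c b * invmx A b a = (a == j)%:R
    & forall k, invmx A k ord_max != 0].

Lemma position_form_general_position n (A : 'M[K]_n.+1) :
  A \in unitmx -> position_form A != 0 -> in_general_position A.
Proof.
move=> uA; rewrite !mulf_eq0 !negb_or => /andP[/andP[]].
move=> /prodf_neq0 lead /prodf_neq0 trail /prodf_neq0 col.
have detA : \det A != 0 by rewrite -unitfE -unitmxE.
split=> // [j|j|k].
- have [c [c0 cA]] := principal_solve (lead j isT) (leqnn j).
  by exists c; split=> // b; rewrite ltnNge => /c0.
- have [c [c0 cA]] := principal_solve (trail j isT) (leqnn j).
  exists (fun b => \det A * c b); split=> [b|a ja].
    by rewrite ltnNge => /c0 ->; rewrite mulr0.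
  rewrite -(cA _ ja); apply: eq_bigr => b _.
  by rewrite /invmx uA !mxE mulrAC mulVKf // mulrC.
- by rewrite /invmx uA mxE mulf_neq0 ?invr_neq0 ?col.
Qed.

End Generic.

(** * Ideals and initial monomials *)

Section Ideals.
Variables (K : fieldType) (N : nat).
Local Notation S := {mpoly K[N]}.

Section IdealGen.
Variable G : S -> Prop.

Lemma ideal_gen_incl f : G f -> ideal_gen G f.
Proof.
move=> Gf; exists [:: (1, f)]; split; last by rewrite big_seq1 mul1r.
by move=> p; rewrite inE => /eqP ->.
Qed.

Lemma ideal_gen0 : ideal_gen G 0.
Proof. by exists [::]; split=> //; rewrite big_nil. Qed.

Lemma ideal_genD f g : ideal_gen G f -> ideal_gen G g -> ideal_gen G (f + g).
Proof.
move=> [s [sG ->]] [t [tG ->]]; exists (s ++ t); split; last by rewrite big_cat.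
by move=> p; rewrite mem_cat => /orP[/sG|/tG].
Qed.

Lemma ideal_genM h f : ideal_gen G f -> ideal_gen G (h * f).
Proof.
move=> [s [sG ->]]; exists [seq (h * p.1, p.2) | p <- s]; split.
  by move=> _ /mapP[p /sG Gp ->].
by rewrite big_map mulr_sumr; apply: eq_bigr => p _; rewrite mulrA.
Qed.

Lemma ideal_gen_ind (P : S -> Prop) :
  P 0 -> (forall f g, P f -> P g -> P (f + g)) ->
  (forall h f, G f -> P (h * f)) -> forall f, ideal_gen G f -> P f.
Proof.
move=> P0 PD PM f [s [sG ->]]; rewrite big_seq.
by apply: (big_ind P) => // p /sG; apply: PM.
Qed.

End IdealGen.

Lemma revlex_lt_irr (u : 'X_{1..N}) : ~~ revlex_lt u u.
Proof.
rewrite /revlex_lt ltnn eqxx /=; apply/existsP => -[k].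
by rewrite ltnn.
Qed.

Lemma revlex_lt_trans : transitive (@revlex_lt N).
Proof.
move=> v u w; rewrite /revlex_lt => /orP[uv|/andP[/eqP uv /existsP[k /andP[k1 /forallP k2]]]].
  by case/orP => [vw|/andP[/eqP <- _]]; rewrite ?uv // (ltn_trans uv vw).
rewrite uv; case/orP => [-> //|/andP[/eqP vw /existsP[l /andP[l1 /forallP l2]]]].
apply/orP; right; rewrite vw eqxx /=.
have [kl|lk|/val_inj kl] := ltngtP k l.
- apply/existsP; exists l; move: (k2 l); rewrite kl => /eqP ->; rewrite l1 /=.
  apply/forallP => h; apply/implyP => lh.
  by move: (l2 h) (k2 h); rewrite lh (ltn_trans kl lh) => /eqP <- /eqP <-.
- apply/existsP; exists k; move: (l2 k); rewrite lk => /eqP <-; rewrite k1 /=.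
  apply/forallP => h; apply/implyP => kh.
  by move: (l2 h) (k2 h); rewrite kh (ltn_trans lk kh) => /eqP <- /eqP <-.
- apply/existsP; exists k; rewrite -kl in l1 l2; rewrite (ltn_trans l1 k1) /=.
  apply/forallP => h; apply/implyP => kh.
  by move: (l2 h) (k2 h); rewrite kh => /eqP <- /eqP <-.
Qed.

Lemma revlex_ltD2l (w u v : 'X_{1..N}) : revlex_lt (w + u)%MM (w + v)%MM = revlex_lt u v.
Proof.
rewrite /revlex_lt !mdegD ltn_add2l eqn_add2l; congr (_ || _ && _).
apply: eq_existsb => k; rewrite !mnmDE ltn_add2l; congr (_ && _).
by apply: eq_forallb => l; rewrite !mnmDE eqn_add2l.
Qed.

Lemma revlex_ltD2r (w u v : 'X_{1..N}) : revlex_lt (u + w)%MM (v + w)%MM = revlex_lt u v.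
Proof. by rewrite ![(_ + w)%MM]addmC revlex_ltD2l. Qed.

(** Reverse lexicographic order is compatible with multiplication, so the product
    of the initial terms cannot cancel. *)
Lemma is_initial_monomialM (f g : S) u v :
  is_initial_monomial f u -> is_initial_monomial g v ->
  is_initial_monomial (f * g) (u + v)%MM.
Proof.
move=> [fu ltu] [gv ltv].
have lt a b : a \in msupp f -> b \in msupp g -> (a != u) || (b != v) ->
    revlex_lt (a + b)%MM (u + v)%MM.
  move=> fa gb; have [->|au _] := eqVneq a u => /=.
    by move=> bv; rewrite revlex_ltD2l ltv.
  have [->|bv] := eqVneq b v; first by rewrite revlex_ltD2r ltu.
  by apply: (@revlex_lt_trans (u + b)%MM); rewrite ?revlex_ltD2l ?revlex_ltD2r (ltu, ltv).
split; last first.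
  move=> w /msuppM_le /allpairsP[[a b] /= [fa gb ->]] ne; apply: lt => //.
  by rewrite -negb_and; apply: contra ne => /andP[/eqP -> /eqP ->].
rewrite mcoeff_msupp; pose f' : S := f - f@_u *: 'X_[u].
have f'E : f = f@_u *: 'X_[u] + f' by rewrite addrC subrK.
have f'u a : a \in msupp f' -> a \in msupp f /\ a != u.
  rewrite !mcoeff_msupp /f' mcoeffB mcoeffZ mcoeffX.
  have [->|ua] := eqVneq u a; first by rewrite mulr1 subrr eqxx.
  by rewrite mulr0 subr0 => ->; split.
rewrite [f in f * g]f'E mulrDl mcoeffD -scalerAl mcoeffZ ['X_[u] * g]mulrC mcoeffMX.
have -> : (f' * g)@_(u + v) = 0.
  apply: memN_msupp_eq0; apply/negP => /msuppM_le /allpairsP[[a b] /= [f'a gb E]].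
  have [fa au] := f'u _ f'a; have := lt _ _ fa gb.
  by rewrite E au (negbTE (revlex_lt_irr _)) => /(_ isT).
by rewrite addr0 mulf_neq0 // -mcoeff_msupp.
Qed.

Lemma is_initial_monomial1 : is_initial_monomial (1 : S) 0%MM.
Proof.
by rewrite /is_initial_monomial msupp1; split=> [|v]; rewrite inE // => /eqP ->; rewrite eqxx.
Qed.

Lemma is_initial_monomial_prod (I : Type) (r : seq I) (P : pred I)
    (f : I -> S) (u : I -> 'X_{1..N}) :
  (forall i, P i -> is_initial_monomial (f i) (u i)) ->
  is_initial_monomial (\prod_(i <- r | P i) f i) (\sum_(i <- r | P i) u i)%MM.
Proof.
move=> fu; apply: (big_rec2 (fun g w => is_initial_monomial g w)).
  exact: is_initial_monomial1.
by move=> i w g Pi gw; apply: is_initial_monomialM => //; apply: fu.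
Qed.

Definition below (u : 'X_{1..N}) (h : S) : Prop :=
  forall v, v \in msupp h -> revlex_lt v u.

Lemma below0 u : below u 0.
Proof. by move=> v; rewrite msupp0. Qed.

Lemma belowD u g h : below u g -> below u h -> below u (g + h).
Proof. by move=> gu hu v /msuppD_le; rewrite mem_cat => /orP[/gu|/hu]. Qed.

Lemma belowZ u c h : below u h -> below u (c *: h).
Proof. by move=> hu v /msuppZ_le /hu. Qed.

Lemma belowX u v : revlex_lt v u -> below u 'X_[v].
Proof. by move=> vu w; rewrite msuppX inE => /eqP ->. Qed.

Lemma below_sum u (J : Type) (r : seq J) (P : pred J) (F : J -> S) :
  (forall i, P i -> below u (F i)) -> below u (\sum_(i <- r | P i) F i).
Proof. by move=> FP; apply: (big_ind (below u)); [apply: below0 | apply: belowD |]. Qed.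

Lemma is_initial_monomialX u h : below u h -> is_initial_monomial ('X_[u] + h) u.
Proof.
move=> hu; split=> [|v].
  rewrite mcoeff_msupp mcoeffD mcoeffX eqxx memN_msupp_eq0 ?addr0 ?oner_neq0 //.
  by apply/negP => /hu; rewrite (negbTE (revlex_lt_irr _)).
by move/msuppD_le; rewrite mem_cat msuppX inE => /orP[/eqP -> /eqP|/hu].
Qed.

End Ideals.

(** * Vertices and their colors *)

Section Vertices.
Variables (d : nat) (n : 'I_d -> nat).

(** Lets one compute a function of the color and the index at a given vertex
    without a cast between the types 'I_(n i). *)
Lemma vtx_elim T (F : forall i, 'I_(n i) -> T) i (j : 'I_(n i)) :
  F (color (vtx j)) (index_in_color (vtx j)) = F i j.
Proof.
pose F' (p : {i & 'I_(n i)}) := F (tag p) (tagged p).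
by rewrite -[LHS]/(F' (tagnat.sig (tagnat.rank (Tagged _ j)))) tagnat.rankK.
Qed.

Lemma vtx_ind (P : 'I_(nvars n) -> Prop) :
  (forall i (j : 'I_(n i)), P (vtx j)) -> forall k, P k.
Proof. by move=> H k; rewrite -[k]tagnat.sig2K; apply: H. Qed.

Lemma eq_vtx i (j l : 'I_(n i)) : (vtx j == vtx l) = (j == l).
Proof. by rewrite -val_eqE tagnat.eq_Rank eqxx. Qed.

Lemma neq_vtx i i' (j : 'I_(n i)) (l : 'I_(n i')) : i != i' -> (vtx j == vtx l) = false.
Proof. by move=> ii'; rewrite -val_eqE tagnat.eq_Rank (negbTE ii'). Qed.

Lemma ltn_vtx i (j l : 'I_(n i)) : (vtx j < vtx l)%N = (j < l)%N.
Proof. exact: tagnat.lt_Rank. Qed.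

Lemma vtx_ltn_neq i (b c : 'I_(n i)) (k : 'I_(nvars n)) :
  (vtx b < k)%N -> (c <= b)%N -> (vtx c == k) = false.
Proof. by move=> bk cb; apply: contraTF bk => /eqP <-; rewrite ltn_vtx -leqNgt. Qed.

Lemma big_vtx R (idx : R) (op : Monoid.com_law idx) (F : 'I_(nvars n) -> R) :
  \big[op/idx]_k F k = \big[op/idx]_i \big[op/idx]_(j < n i) F (vtx j).
Proof.
rewrite sig_big_dep /= (reindex _ tagnat.sig_bij_on) /=.
by apply: eq_bigr => k _; rewrite /vtx -tagnat.rankE tagnat.sigK.
Qed.

Lemma prod_sum_fprod (R : comNzRingType) (F : forall i, 'I_(n i) -> R) :
  \prod_i \sum_(j < n i) F i j =
  \sum_(t : fprod (fun i => 'I_(n i))) \prod_i F i (t i).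
Proof.
transitivity (\sum_(t : fprod (fun i => 'I_(n i))) \prod_i [ffun j => F i j] (t i)); last first.
  by apply: eq_bigr => t _; apply: eq_bigr => i _; rewrite ffunE.
rewrite (@big_fprod _ _ _ _ _ _ _ (fun i => [ffun j => F i j])).
rewrite -(bigA_distr_big_dep _ (fun i j => untag 0 [ffun j => F i j] j)).
apply: eq_bigr => i _; rewrite -(big_tag (fun i => [ffun j => F i j])).
by apply: eq_bigr => j _; rewrite ffunE.
Qed.

End Vertices.

(** * Balanced squeezed complexes *)

Section Squeezed.
Variables (d : nat) (m : 'I_d -> nat).
Local Notation M := (nvars (msucc m)).
Local Notation last i := (@ord_max (m i) : 'I_(msucc m i)).
Local Notation old j := (widen_ord (leqnSn _) j : 'I_(msucc m _)).

Variant msucc_spec i : 'I_(msucc m i) -> Type :=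
  | MsuccOld (j : 'I_(m i)) : msucc_spec (old j)
  | MsuccLast : msucc_spec (last i).

Lemma msuccP i (k : 'I_(msucc m i)) : msucc_spec k.
Proof.
have [lt|ge] := ltnP k (m i).
  have -> : k = old (Ordinal lt) by apply: val_inj.
  by constructor.
have -> : k = last i by apply/val_inj/eqP; rewrite eqn_leq ge -ltnS (ltn_ord k).
by constructor.
Qed.

Lemma old_eq i (j l : 'I_(m i)) : (old j == old l) = (j == l).
Proof. by []. Qed.

Lemma old_last i (j : 'I_(m i)) : (old j == last i) = false.
Proof. by rewrite -val_eqE /= ltn_eqF. Qed.

Lemma last_old i (j : 'I_(m i)) : (last i == old j) = false.
Proof. by rewrite eq_sym old_last. Qed.

Lemma old_vertex_vtx i (j : 'I_(m i)) : old_vertex (vtx j) = vtx (old j).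
Proof. exact: (@vtx_elim d m _ (fun i j => vtx (old j)) i j). Qed.

(** The last index stands for the absence of the color, so a word, which picks one
    index per color, encodes a color-squarefree monomial and also the corresponding facet. *)
Definition old_part i (k : 'I_(msucc m i)) : 'X_{1..nvars m} :=
  if insub (k : nat) is Some j then U_(@vtx d m i j)%MM else 0%MM.

Lemma old_part_old i (j : 'I_(m i)) : old_part (old j) = U_(vtx j)%MM.
Proof. by rewrite /old_part /= valK. Qed.

Lemma old_part_last i : old_part (last i) = 0%MM.
Proof. by rewrite /old_part insubF //= ltnn. Qed.

Definition word_monomial (w : forall i, 'I_(msucc m i)) : 'X_{1..nvars m} :=
  (\sum_i old_part (w i))%MM.

Lemma old_partE i (k : 'I_(msucc m i)) i' (j : 'I_(m i')) :
  old_part k (vtx j) = (if i == i' then k == j :> nat else false).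
Proof.
case: (msuccP k) => [l|]; rewrite ?old_part_old ?old_part_last ?mnmE.
  case: (eqVneq i i') => [E|/neq_vtx -> //].
  by case: _ / E in j *; rewrite eq_vtx.
case: eqP => // E; case: _ / E in j *.
by rewrite /= gtn_eqF.
Qed.

Lemma word_monomialE w i (j : 'I_(m i)) : word_monomial w (vtx j) = (w i == old j).
Proof.
rewrite mnm_sumE (bigD1 i) //= big1 => [|i' /negbTE ii']; last by rewrite old_partE ii'.
by rewrite addn0 old_partE eqxx.
Qed.

Definition word_of (x : 'X_{1..nvars m}) i : 'I_(msucc m i) :=
  if [pick j : 'I_(m i) | 0 < x (vtx j)]%N is Some j then old j else last i.

Lemma word_ofK x : color_squarefree x -> word_monomial (word_of x) = x.
Proof.
move=> [x1 xc]; apply/mnmP; elim/vtx_ind => i j; rewrite word_monomialE /word_of.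
case: pickP => [l xl|x0]; last first.
  by rewrite last_old; move: (x0 j); rewrite lt0n => /negbFE/eqP.
rewrite old_eq; have [<-|lj] := eqVneq l j.
  by apply/eqP; rewrite eqn_leq xl x1.
by case: (posnP (x (vtx j))) => // /(xc _ _ _ xl) E; rewrite E eqxx in lj.
Qed.

Definition old_monomial (u : 'X_{1..M}) : 'X_{1..nvars m} :=
  [multinom u (old_vertex k) | k < nvars m].

Lemma old_monomialE u i (j : 'I_(m i)) : old_monomial u (vtx j) = u (vtx (old j)).
Proof. by rewrite mnmE old_vertex_vtx. Qed.

Definition color_deg (u : 'X_{1..M}) : 'X_{1..d} :=
  [multinom \sum_(j < msucc m i) u (vtx j) | i < d].

Lemma color_degE u i :
  color_deg u i = (\sum_(j < m i) u (vtx (old j)) + u (vtx (last i)))%N.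
Proof. by rewrite mnmE big_ord_recr. Qed.

Lemma old_vertex_in_facet x i (j : 'I_(m i)) :
  (vtx (old j) \in squeezed_facet x) = (0 < x (vtx j))%N.
Proof.
rewrite inE; apply/orP/idP => [[/imsetP[]|/imsetP[i' _]]|xj].
- elim/vtx_ind => i' l; rewrite inE old_vertex_vtx => xl.
  have [E|/neq_vtx E /eqP] := eqVneq i i'; last by rewrite E.
  case: _ / E in l xl *; move/eqP; rewrite eq_vtx old_eq => /eqP ->.
  by [].
- rewrite /new_vertex; have [E|/neq_vtx E /eqP] := eqVneq i i'; last by rewrite E.
  by case: _ / E => /eqP; rewrite eq_vtx old_last.
- by left; apply/imsetP; exists (vtx j); rewrite ?inE ?old_vertex_vtx.
Qed.

Lemma new_vertex_in_facet x i :
  (vtx (last i) \in squeezed_facet x) = [forall j : 'I_(m i), x (vtx j) == 0%N].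
Proof.
rewrite inE; apply/orP/idP => [[/imsetP[]|/imsetP[i']]|x0].
- elim/vtx_ind => i' l; rewrite inE old_vertex_vtx => xl.
  have [E|/neq_vtx E /eqP] := eqVneq i i'; last by rewrite E.
  by case: _ / E in l xl *; move/eqP; rewrite eq_vtx last_old.
- rewrite inE /new_vertex => x0.
  have [E|/neq_vtx E /eqP] := eqVneq i i'; last by rewrite E.
  by case: _ / E in x0 *.
- by right; apply/imsetP; exists i; rewrite ?inE.
Qed.

Lemma vtx_in_word_facet w i (k : 'I_(msucc m i)) :
  (vtx k \in squeezed_facet (word_monomial w)) = (k == w i).
Proof.
case: (msuccP k) => [j|].
  by rewrite old_vertex_in_facet word_monomialE lt0b eq_sym.
rewrite new_vertex_in_facet; apply/forallP/eqP => [w0|E j]; last first.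
  by rewrite word_monomialE -E last_old.
have {}w0 j : (w i == old j) = false.
  by move/(_ j): w0; rewrite word_monomialE eqb0 => /negbTE.
by case: (msuccP (w i)) w0 => // j /(_ j); rewrite eqxx.
Qed.

Section OrderIdeal.
Variable U : 'X_{1..nvars m} -> Prop.
Hypothesis U_ideal : color_squarefree_order_ideal U.

(** The facets are the words whose monomial lies in U, a word being the set of its
    vertices. *)
Lemma balanced_squeezedP (G : {set 'I_M}) :
  balanced_squeezed U G <-> exists2 w, U (word_monomial w) &
    forall i (k : 'I_(msucc m i)), vtx k \in G -> k = w i.
Proof.
case: U_ideal => Ucsf _ _ _; split=> [[x Ux /subsetP Gx]|[w Uw Gw]].
  have := word_ofK (Ucsf _ Ux) => E; exists (word_of x); first by rewrite E.
  by move=> i k /Gx; rewrite -E vtx_in_word_facet => /eqP ->; rewrite E.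
exists (word_monomial w) => //; apply/subsetP; elim/vtx_ind => i k /Gw ->.
by rewrite vtx_in_word_facet.
Qed.

Hypothesis U_shifted : color_squarefree_shifted U.

(** Raising an index within the old ones is shiftedness; raising it to the last one
    deletes a variable. *)
Lemma shifted_old_part x i (k l : 'I_(msucc m i)) :
  (k <= l)%N -> U (old_part k + x)%MM -> U (old_part l + x)%MM.
Proof.
case: U_ideal => _ Udiv _ _.
case: (msuccP l) => [b|_]; last first.
  by rewrite old_part_last add0m; apply: Udiv; apply: lem_addl.
case: (msuccP k) => [a|] /=; last by rewrite leqNgt ltn_ord.
by rewrite !old_part_old; apply: U_shifted.
Qed.

(** The words of U form an upper set for the componentwise order. *)
Lemma shifted_word_monomial (w v : forall i, 'I_(msucc m i)) :
  (forall i, (w i <= v i)%N) -> U (word_monomial w) -> U (word_monomial v).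
Proof.
move=> wv; suff H r x : U (x + \sum_(i <- r) old_part (w i))%MM ->
    U (x + \sum_(i <- r) old_part (v i))%MM.
  by have := H (index_enum 'I_d) 0%MM; rewrite !add0m.
elim: r x => [|i r IH] x; first by rewrite !big_nil.
rewrite !big_cons !addmA => Ux; apply: IH.
rewrite -[X in U (X + _)%MM]addmC -addmA; apply: (shifted_old_part (wv i)).
by rewrite addmA [(old_part _ + x)%MM]addmC.
Qed.

(** A standard monomial has in each color i the form last^(b_i - 1) x_{w_i}, or 1 if
    the degree b_i is 0 (and then w_i is last). Multiplying by the last variable puts
    both cases into the single equation last^(b_i) x_{w_i}. *)
Lemma standard_color (u : 'X_{1..M}) : U (old_monomial u) ->
  exists2 w, U (word_monomial w) &
  forall i (k : 'I_(msucc m i)),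
    (u (vtx k) + (k == last i) = color_deg u i * (k == last i) + (k == w i))%N.
Proof.
case: U_ideal => Ucsf _ _ _ Uu; pose w := word_of (old_monomial u).
have E : word_monomial w = old_monomial u by apply: word_ofK; apply: Ucsf.
have uw i (j : 'I_(m i)) : u (vtx (old j)) = (w i == old j).
  by rewrite -word_monomialE E old_monomialE.
exists w => [|i k]; first by rewrite E.
rewrite color_degE; case: (msuccP k) => [j|].
  by rewrite uw old_last muln0 addn0 eq_sym.
rewrite eqxx muln1 addn1 addnAC -addn1 [in LHS]addnC; congr addn.
under eq_bigr => j _ do rewrite uw.
case: (msuccP (w i)) => [j|].
  rewrite last_old addn0 (bigD1 j) //= eqxx big1 // => l lj.
  by rewrite old_eq eq_sym (negbTE lj).
by rewrite eqxx big1 // => j _; rewrite last_old.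
Qed.

End OrderIdeal.
End Squeezed.

(** * Initial monomials in generic coordinates are nonstandard *)

Section GenericCoordinates.
Variables (K : fieldType) (d : nat) (m : 'I_d -> nat).
Local Notation M := (nvars (msucc m)).
Local Notation S := {mpoly K[M]}.
Local Notation last i := (@ord_max (m i) : 'I_(msucc m i)).
Local Notation old j := (widen_ord (leqnSn _) j : 'I_(msucc m _)).

Variable phi : forall i, 'M[K]_(msucc m i).
Hypothesis phi_gp : forall i, @in_general_position K (m i) (phi i).

Definition phi_inv i : 'M[K]_(msucc m i) := invmx (phi i).

Definition moved_var i (k : 'I_(msucc m i)) : S :=
  \sum_(l < msucc m i) phi i l k *: 'X_(vtx l).

Lemma gl_act_vtx i (k : 'I_(msucc m i)) : gl_act phi 'X_(vtx k) = moved_var k.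
Proof.
rewrite /gl_act comp_mpolyXU -tnth_nth tnth_mktuple.
exact: (vtx_elim (fun i k => @moved_var i k)).
Qed.

Lemma var_moved_var i (l : 'I_(msucc m i)) :
  'X_(vtx l) = \sum_k phi_inv i k l *: moved_var k.
Proof.
have [u _ _ _] := phi_gp i.
under eq_bigr => k _ do rewrite scaler_sumr.
rewrite exchange_big /= (bigD1 l) //= [X in _ + X]big1 => [|a al].
  rewrite addr0; under eq_bigr => k _ do rewrite scalerA mulrC.
  rewrite -scaler_suml; have /matrixP/(_ l l) := mulmxV u.
  by rewrite !mxE eqxx => ->; rewrite scale1r.
under eq_bigr => k _ do rewrite scalerA mulrC.
rewrite -scaler_suml; have /matrixP/(_ a l) := mulmxV u.
by rewrite !mxE (negbTE al) => ->; rewrite scale0r.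
Qed.

(** In the coordinates y this is y_{i,k} |-> t_i if k = w i and 0 otherwise
    ([facet_restriction_moved_var]): the restriction to the coordinate subspace of the
    facet w. Written in the coordinates x it involves the row w i of the inverse
    matrix. *)
Definition facet_restriction (w : forall i, 'I_(msucc m i)) (f : S) : {mpoly K[d]} :=
  f \mPo [tuple phi_inv (color k) (w (color k)) (index_in_color k) *: 'X_(color k) | k < M].

Lemma facet_restriction_vtx w i (l : 'I_(msucc m i)) :
  facet_restriction w 'X_(vtx l) = phi_inv i (w i) l *: 'X_i.
Proof.
rewrite /facet_restriction comp_mpolyXU -tnth_nth tnth_mktuple.
exact: (vtx_elim (fun i l => phi_inv i (w i) l *: 'X_i)).
Qed.

Lemma facet_restriction_moved_var w i (k : 'I_(msucc m i)) :
  facet_restriction w (moved_var k) = (k == w i)%:R *: 'X_i.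
Proof.
have [u _ _ _] := phi_gp i.
rewrite /facet_restriction raddf_sum /=.
transitivity (\sum_(l < msucc m i) (phi_inv i (w i) l * phi i l k) *: 'X_i : {mpoly K[d]}).
  apply: eq_bigr => l _; rewrite comp_mpolyZ.
  by have := facet_restriction_vtx w l; rewrite /facet_restriction => ->; rewrite scalerA mulrC.
rewrite -scaler_suml; have /matrixP/(_ (w i) k) := mulVmx u.
by rewrite !mxE [_ == k]eq_sym => ->.
Qed.

Variable U : 'X_{1..nvars m} -> Prop.
Hypothesis U_ideal : color_squarefree_order_ideal U.
Local Notation I := (stanley_reisner K (balanced_squeezed U)).

(** A nonface has a vertex off the facet, and the restriction kills the variable of
    that vertex. *)
Lemma facet_restriction_image w g :
  U (word_monomial w) -> ideal_image phi I g -> facet_restriction w g = 0.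
Proof.
move=> Uw [f If ->] {g}; rewrite /facet_restriction /gl_act; move: f If.
apply: ideal_gen_ind => [|f g Pf Pg|h f [G nG ->]].
- by rewrite !comp_mpoly0.
- by rewrite !comp_mpolyD Pf Pg addr0.
have [/forall_inP Gw|] := boolP [forall k in G, k == vtx (w (color k))].
  case: nG; apply/(balanced_squeezedP U_ideal); exists w => // i k /Gw.
  by rewrite (vtx_elim (fun i _ => vtx (w i))) eq_vtx => /eqP.
rewrite negb_forall_in => /exists_inP[k0]; elim/vtx_ind: k0 => i k kG kw.
rewrite !rmorphM (bigD1 (vtx k)) //= !rmorphM /=.
have := facet_restriction_moved_var w k; rewrite -gl_act_vtx.
rewrite /facet_restriction /gl_act => ->.
move: kw; rewrite (vtx_elim (fun i _ => vtx (w i))) eq_vtx => /negbTE ->.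
by rewrite scale0r mul0r mulr0.
Qed.

Definition color_value i (k : 'I_(msucc m i)) (v : 'X_{1..M}) : K :=
  \prod_(l < msucc m i) phi_inv i k l ^+ v (vtx l).

Lemma facet_restriction_monomial w v :
  facet_restriction w 'X_[v] = (\prod_i color_value (w i) v) *: 'X_[color_deg v].
Proof.
rewrite /facet_restriction comp_mpolyX big_vtx.
rewrite -mul_mpolyC rmorph_prod mpolyXE_id -big_split /=.
apply: eq_bigr => i _; rewrite rmorph_prod mnmE -prodrXr -big_split /=.
apply: eq_bigr => l _; rewrite tnth_mktuple.
rewrite (vtx_elim (fun i l => phi_inv i (w i) l *: 'X_i)).
by rewrite exprZn -mul_mpolyC.
Qed.

Lemma mcoeff_facet_restriction w g b :
  (facet_restriction w g)@_b =
  \sum_(v <- msupp g) g@_v * ((color_deg v == b)%:R * \prod_i color_value (w i) v).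
Proof.
rewrite /facet_restriction comp_mpolyEX raddf_sum /=; apply: eq_bigr => v _.
have := facet_restriction_monomial w v; rewrite /facet_restriction => ->.
by rewrite !mcoeffZ mcoeffX [_%:R * _]mulrC.
Qed.

(** For a standard color part the value is linear in the row k of the inverse matrix, up
    to a power of its last entry. This is the only case in which the functionals of
    [initial_monomial_nonstandard] have to be evaluated. *)
Lemma color_value_standard i (j k : 'I_(msucc m i)) (v : 'X_{1..M}) b :
  (forall l : 'I_(msucc m i), (v (vtx l) + (l == last i) = b * (l == last i) + (l == j))%N) ->
  color_value k v * phi_inv i k (last i) = phi_inv i k (last i) ^+ b * phi_inv i k j.
Proof.
move=> vE; have pick c (a : 'I_(msucc m i)) :
    phi_inv i k a ^+ c = \prod_l phi_inv i k l ^+ (c * (l == a)).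
  rewrite (bigD1 a) //= eqxx muln1 big1 ?mulr1 // => l /negbTE ->.
  by rewrite muln0.
rewrite -[phi_inv i k (last i) in LHS]expr1 -[phi_inv i k j]expr1 !pick -!big_split /=.
by apply: eq_bigr => l _; rewrite -!exprD !mul1n vE.
Qed.

(** Let u be standard. In the color i of the last vertex where u and v differ, v has the larger
    exponent there and agrees with u after it. As u consists there of a power
    of the last variable and at most one more variable, the degree
    leaves v only one possibility: a standard color part with an index j > w i. *)
Lemma standard_below (u v : 'X_{1..M}) (w : forall i, 'I_(msucc m i)) :
  (forall i (k : 'I_(msucc m i)),
    (u (vtx k) + (k == last i) = color_deg u i * (k == last i) + (k == w i))%N) ->
  revlex_lt v u -> color_deg v = color_deg u ->
  exists i, exists2 j : 'I_(msucc m i), (w i < j)%N &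
  forall l : 'I_(msucc m i),
    (v (vtx l) + (l == last i) = color_deg u i * (l == last i) + (l == j))%N.
Proof.
move=> uE vu vb.
have /existsP[k0] : [exists k : 'I_M, (u k < v k)%N &&
     [forall l : 'I_M, (k < l)%N ==> (v l == u l)]].
  have deg x : mdeg x = (\sum_i color_deg x i)%N.
    by rewrite mdegE big_vtx; apply: eq_bigr => i _; rewrite mnmE.
  by move: vu; rewrite /revlex_lt !deg vb ltnn eqxx.
elim/vtx_ind: k0 => i k /andP[uvk /forallP vu'].
have {}vu' (l : 'I_(msucc m i)) : (k < l)%N -> v (vtx l) = u (vtx l).
  by move=> kl; have := vu' (vtx l); rewrite ltn_vtx kl => /eqP.
exists i; move/(congr1 (fun x : 'X_{1..d} => x i)): vb; rewrite color_degE => vb.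
have uw := uE i; have := uw (last i); rewrite eqxx muln1 addn1 => ulast.
(* If the deciding vertex is old, v contains it exactly once; if it is the last
   one, v is a pure power of it in this color. *)
case: (msuccP k) uvk vu' => [j|] uvk vu'.
  have vlast : v (vtx (last i)) = u (vtx (last i)) by apply: vu' => /=.
  rewrite (bigD1 j) //= in vb.
  have wl : last i == w i = false by apply/negP => E; rewrite E in ulast; lia.
  rewrite wl in ulast.
  have vj : v (vtx (old j)) = 1%N by lia.
  have v0 (l : 'I_(m i)) : l != j -> v (vtx (old l)) = 0%N.
    by move=> lj; move: vb; rewrite (bigD1 l) //=; lia.
  exists (old j); last first.
    move=> l; case: (msuccP l) => [a|]; last by rewrite eqxx last_old; lia.
    rewrite old_last muln0 addn0 old_eq; have [->|/v0 -> //] := eqVneq a j.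
    by rewrite vj.
  rewrite ltnNge leq_eqVlt; apply/norP; split.
    apply/negP => /eqP/val_inj E; have := uw (old j).
    by rewrite -E eqxx old_last; lia.
  apply/negP => jw; have := uw (w i); have := vu' _ jw.
  case: (msuccP (w i)) wl jw => [a _ /= ja|]; last by rewrite eqxx.
  rewrite eqxx old_last v0; first by lia.
  by apply: contraTneq ja => ->; rewrite ltnn.
have wl : last i == w i = false by apply/negP => E; rewrite E in ulast; lia.
rewrite wl in ulast.
exists (last i).
  case: (msuccP (w i)) wl => [a _ /=|]; last by rewrite eqxx.
  exact: ltn_ord.
have v0 (l : 'I_(m i)) : v (vtx (old l)) = 0%N.
  by move: vb; rewrite (bigD1 l) //=; lia.
move=> l; case: (msuccP l) => [a|]; last by rewrite eqxx; lia.
by rewrite old_last v0 muln0.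
Qed.

Hypothesis U_shifted : color_squarefree_shifted U.

(** The functional is the sum over all words t of the coefficient of multidegree b in the
    restriction to t, with weights prod_i lam i (t i). The weights vanish unless t >= w,
    so that only facets contribute and the functional kills phi I. As the weights
    are products, the value at a monomial v is a product over the colors; [c] makes
    it 1 at u, and 0 in the color found by [standard_below] for v < u. *)
Lemma initial_monomial_nonstandard g u :
  ideal_image phi I g -> is_initial_monomial g u -> ~ U (old_monomial u).
Proof.
move=> Ig [gu ltu] /(standard_color U_ideal)[w Uw uE].
have /fin_all_exists[c cP] i : exists c : 'I_(msucc m i) -> K,
    (forall k : 'I_(msucc m i), (k < w i)%N -> c k = 0) /\
    forall a : 'I_(msucc m i), (w i <= a)%N -> \sum_k c k * phi_inv i k a = (a == w i)%:R.
  by have [_ _ H _] := phi_gp i; apply: H.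
have psi0 i k : phi_inv i k (last i) != 0 by have [_ _ _ H] := phi_gp i; apply: H.
pose b := color_deg u.
(* The power of the last entry of the row cancels the one in
   [color_value_standard]. *)
pose lam i k := c i k * phi_inv i k (last i) / phi_inv i k (last i) ^+ b i.
have lamE i (j : 'I_(msucc m i)) (v : 'X_{1..M}) : (w i <= j)%N ->
    (forall l : 'I_(msucc m i),
      (v (vtx l) + (l == last i) = b i * (l == last i) + (l == j))%N) ->
    \sum_k lam i k * color_value k v = (j == w i)%:R.
  move=> wj vE; have [_ <- //] := cP i; apply: eq_bigr => k _.
  rewrite /lam mulrAC -(mulrA (c i k)) [phi_inv i k _ * color_value _ _]mulrC.
  rewrite (color_value_standard k vE) [_ ^+ _ * phi_inv i k j]mulrC mulrA mulfK //.
  by rewrite expf_neq0.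
have : \sum_(t : fprod (fun i => 'I_(msucc m i)))
    (\prod_i lam i (t i)) * (facet_restriction t g)@_b = 0.
  apply: big1 => t _; have [/forallP wt|] := boolP [forall i, (w i <= t i)%N].
    rewrite facet_restriction_image ?mcoeff0 ?mulr0 //.
    exact: (shifted_word_monomial U_ideal U_shifted wt).
  rewrite negb_forall => /existsP[i]; rewrite -ltnNge => ti.
  by rewrite (bigD1 i) //= /lam; have [-> //] := cP i; rewrite !mul0r.
under eq_bigr => t _ do rewrite mcoeff_facet_restriction mulr_sumr.
rewrite exchange_big /=.
rewrite (eq_bigr (fun v => g@_v * ((color_deg v == b)%:R *
    \prod_i \sum_k lam i k * color_value k v))); last first.
  move=> v _; rewrite prod_sum_fprod !mulr_sumr; apply: eq_bigr => t _.
   by rewrite mulrCA; congr (_ * _); rewrite mulrCA; congr (_ * _); rewrite -big_split.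
rewrite (bigD1_seq u) //= ?msupp_uniq // [X in _ + X]big1_seq => [|v].
  rewrite eqxx big1 => [|i _]; last by rewrite (lamE i (w i) u) // eqxx.
  by rewrite /= !mulr1 addr0 => g0; rewrite mcoeff_msupp g0 eqxx in gu.
move=> /andP[vu gv]; have [vb|] := eqVneq (color_deg v) b; last by rewrite mul0r mulr0.
have [i [j wj vE]] := standard_below uE (ltu v gv vu) vb.
rewrite (bigD1 i) //= (lamE i j) ?(ltnW wj) //.
by rewrite -val_eqE /= gtn_eqF // mul0r !mulr0.
Qed.

End GenericCoordinates.

(** * Every nonstandard monomial is initial in generic coordinates *)

Section Lower.
Variables (K : fieldType) (d : nat) (m : 'I_d -> nat).
Local Notation M := (nvars (msucc m)).
Local Notation S := {mpoly K[M]}.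
Local Notation last i := (@ord_max (m i) : 'I_(msucc m i)).
Local Notation old j := (widen_ord (leqnSn _) j : 'I_(msucc m _)).

Variable phi : forall i, 'M[K]_(msucc m i).

Section Image.
Variable I : S -> Prop.
Hypothesis I0 : I 0.
Hypothesis ID : forall f g, I f -> I g -> I (f + g).
Hypothesis IZ : forall c f, I f -> I (c *: f).

Lemma ideal_image0 : ideal_image phi I 0.
Proof. by exists 0 => //; rewrite /gl_act comp_mpoly0. Qed.

Lemma ideal_imageD f g : ideal_image phi I f -> ideal_image phi I g -> ideal_image phi I (f + g).
Proof.
move=> [f0 If ->] [g0 Ig ->]; exists (f0 + g0); first exact: ID.
by rewrite /gl_act comp_mpolyD.
Qed.

Lemma ideal_imageZ c f : ideal_image phi I f -> ideal_image phi I (c *: f).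
Proof.
by move=> [f0 If ->]; exists (c *: f0); [exact: IZ | rewrite /gl_act comp_mpolyZ].
Qed.

Lemma ideal_image_sum (J : Type) (r : seq J) (P : pred J) (F : J -> S) :
  (forall i, P i -> ideal_image phi I (F i)) -> ideal_image phi I (\sum_(i <- r | P i) F i).
Proof.
move=> FP; apply: (big_ind (ideal_image phi I)) => //.
  exact: ideal_image0.
exact: ideal_imageD.
Qed.
End Image.

Variable U : 'X_{1..nvars m} -> Prop.
Hypothesis U_ideal : color_squarefree_order_ideal U.
Local Notation I := (stanley_reisner K (balanced_squeezed U)).
Local Notation phiI := (ideal_image phi I).

Let I0 : I 0 := @ideal_gen0 _ _ _.
Let ID : forall f g, I f -> I g -> I (f + g) := @ideal_genD _ _ _.
Let IZ c f : I f -> I (c *: f).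
Proof. by rewrite -mul_mpolyC; apply: ideal_genM. Qed.

Definition word_var i (k : 'I_(msucc m i)) : S :=
  if k == last i then 1 else 'X_(vtx k).

(** A facet has one vertex of each color. *)
Lemma same_color_nonface i (a b : 'I_(msucc m i)) : a != b -> I ('X_(vtx a) * 'X_(vtx b)).
Proof.
move=> ab; apply: ideal_gen_incl; exists [set vtx a; vtx b].
  move=> /(balanced_squeezedP U_ideal)[w _ wG].
  have aE : a = w i by apply: wG; rewrite inE set11.
  have bE : b = w i by apply: wG; rewrite inE set11 orbT.
  by rewrite aE bE eqxx in ab.
by rewrite big_setU1 ?big_set1 //= inE eq_vtx.
Qed.

(** A facet containing these vertices would have a monomial that is a multiple of the
    given one. *)
Lemma word_nonface w : ~ U (word_monomial w) -> I (\prod_i word_var (w i)).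
Proof.
case: U_ideal => _ Udiv _ _.
move=> nU; apply: ideal_gen_incl; exists [set vtx (w i) | i : 'I_d & w i != last i].
  move=> /(balanced_squeezedP U_ideal)[v Uv vG]; case: nU; apply: Udiv Uv.
  apply/mnm_lepP; elim/vtx_ind => i j; rewrite !word_monomialE.
  have [E|//] := eqVneq (w i) (old j).
  have <- : w i = v i by apply: vG; apply/imsetP; exists i; rewrite // inE E old_last.
  by rewrite E eqxx.
rewrite [RHS]big_imset /=; last first.
  move=> i i' _ _ E; case: (eqVneq i i') => // /neq_vtx.
  by move/(_ _ (w i) (w i')); rewrite E eqxx.
rewrite [LHS]big_mkcond [RHS]big_mkcond; apply: eq_bigr => i _.
by rewrite inE /word_var /=; case: eqP.
Qed.

Hypothesis phi_gp : forall i, @in_general_position K (m i) (phi i).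
Local Notation phi_inv := (phi_inv phi).
Local Notation Y := (moved_var phi).

Lemma moved_same_color i (a b : 'I_(msucc m i)) : a != b -> phiI (Y a * Y b).
Proof.
move=> ab; exists ('X_(vtx a) * 'X_(vtx b)); first exact: same_color_nonface.
by rewrite -!gl_act_vtx /gl_act rmorphM.
Qed.

(** Expand x_j x_l and last * y_b in the y's. The products y_a y_b with a != b lie in
    phi I, and the coefficients e_b are chosen to cancel the squares y_b^2. *)
Lemma same_color_initial i (j l : 'I_(m i)) :
  exists2 g, phiI g & is_initial_monomial g (U_(vtx (old j)) + U_(vtx (old l)))%MM.
Proof.
have psi0 k : phi_inv i k (last i) != 0 by have [_ _ _ H] := phi_gp i; apply: H.
pose e b := phi_inv i b (old j) * phi_inv i b (old l) / phi_inv i b (last i).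
exists ('X_[(U_(vtx (old j)) + U_(vtx (old l)))] + - 1 *: ('X_(vtx (last i)) * \sum_b e b *: Y b)).
  rewrite mpolyXD !(var_moved_var phi_gp) scaleN1r !mulr_suml -sumrB.
  apply: (ideal_image_sum I0 ID) => a _; rewrite !mulr_sumr -sumrB.
  apply: (ideal_image_sum I0 ID) => b _.
  rewrite -!scalerAl -!scalerAr !scalerA -scalerBl.
  have [<-|ab] := eqVneq a b; last by apply/(ideal_imageZ IZ)/moved_same_color.
  by rewrite [_ * e a]mulrC /e divfK // subrr scale0r; apply: ideal_image0.
apply: is_initial_monomialX; apply: belowZ; rewrite mulr_sumr; apply: below_sum => b _.
rewrite -scalerAr; apply: belowZ; rewrite /moved_var mulr_sumr; apply: below_sum => a _.
rewrite -scalerAr; apply: belowZ; rewrite -mpolyXD; apply: belowX.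
rewrite /revlex_lt !mdegD !mdeg1 eqxx /=; apply/existsP; exists (vtx (last i)).
rewrite !mnmDE !mnm1E !eq_vtx !old_last eqxx addn_gt0 /=.
apply/forallP => k; apply/implyP => lt.
by rewrite !mnmDE !mnm1E !(vtx_ltn_neq lt) // -ltnS ltn_ord.
Qed.

Hypothesis U_shifted : color_squarefree_shifted U.

Definition word_mon i (k : 'I_(msucc m i)) : 'X_{1..M} :=
  if k == last i then 0%MM else U_(vtx k)%MM.

(** In each color, eliminate with the columns up to w i to get a linear form whose
    initial variable has index w i; multiply these forms. In the expansion of the
    product, all words t are <= w, hence outside U like w. *)
Lemma word_initial w : ~ U (word_monomial w) ->
  exists2 g, phiI g & is_initial_monomial g (\sum_i word_mon (w i))%MM.
Proof.
move=> nU; pose Y' i (k : 'I_(msucc m i)) : S := if k == last i then 1 else Y k.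
have /fin_all_exists[c cP] i : exists c : 'I_(msucc m i) -> K,
    (forall b : 'I_(msucc m i), (w i < b)%N -> c b = 0) /\
    is_initial_monomial (\sum_b c b *: Y' i b) (word_mon (w i)).
  (* A color absent from w contributes the factor 1, which is the
     value of Y' at the last index. *)
  case: (msuccP (w i)) => [j|]; last first.
    exists (fun b => (b == last i)%:R); split.
      by move=> b; rewrite ltnNge -ltnS ltn_ord.
    rewrite (bigD1 (last i)) //= big1 => [|b /negbTE ->]; last by rewrite scale0r.
    rewrite /word_mon /Y' eqxx scale1r addr0; exact: is_initial_monomial1.
  have [_ /(_ (old j))[c [c0 cE]] _ _] := phi_gp i; exists c; split=> //.
  have -> : \sum_b c b *: Y' i b =
      'X_(vtx (old j)) + \sum_(a < msucc m i | (j < a)%N) (\sum_b phi i a b * c b) *: 'X_(vtx a).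
    transitivity (\sum_a (\sum_b phi i a b * c b) *: 'X_(vtx a) : S).
      under [RHS]eq_bigr => a _ do rewrite scaler_suml.
      rewrite exchange_big; apply: eq_bigr => b _ /=; rewrite /Y'.
      have [->|_] := eqVneq b (last i).
        rewrite c0 /= ?ltn_ord // scale0r big1 // => a _.
        by rewrite mulr0 scale0r.
      rewrite /moved_var scaler_sumr; apply: eq_bigr => a _.
      by rewrite scalerA mulrC.
    rewrite (bigID (fun a : 'I_(msucc m i) => a <= j)%N) /=; congr (_ + _).
      rewrite (bigD1 (old j)) //=. rewrite [X in _ + X]big1 => [|a /andP[aj /negbTE na]].
        by rewrite cE //= eqxx scale1r addr0.
      by rewrite cE // na scale0r.
    by apply: eq_bigl => a; rewrite ltnNge.
  rewrite /word_mon old_last; apply: is_initial_monomialX; apply: below_sum => a ja.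
  apply: belowZ; apply: belowX; rewrite /revlex_lt !mdeg1 eqxx /=.
  apply/existsP; exists (vtx a); rewrite !mnm1E !eq_vtx eqxx -val_eqE /= ltn_eqF //=.
  apply/forallP => k; apply/implyP => lt.
  by rewrite !mnm1E !(vtx_ltn_neq lt) // ltnW.
exists (\prod_i \sum_b c i b *: Y' i b); last first.
  by apply: is_initial_monomial_prod => i _; have [] := cP i.
rewrite prod_sum_fprod; apply: (ideal_image_sum I0 ID) => t _.
have -> : \prod_i (c i (t i) *: Y' i (t i)) =
    (\prod_i c i (t i)) *: gl_act phi (\prod_i word_var (t i)).
  rewrite -mul_mpolyC rmorph_prod /gl_act rmorph_prod -big_split /=.
  apply: eq_bigr => i _; rewrite mul_mpolyC /Y' /word_var; case: eqP => _.
    by rewrite rmorph1.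
  by rewrite -gl_act_vtx.
have [/forallP tw|] := boolP [forall i, (t i <= w i)%N].
  apply: (ideal_imageZ IZ); exists (\prod_i word_var (t i)) => //.
  apply: word_nonface => Ut; apply: nU.
  exact: (shifted_word_monomial U_ideal U_shifted tw).
rewrite negb_forall => /existsP[i]; rewrite -ltnNge => wt.
rewrite (bigD1 i) //=; have [-> // _] := cP i; rewrite mul0r scale0r.
exact: ideal_image0.
Qed.

Definition nonstandard (f : S) : Prop := forall v, v \in msupp f -> ~ U (old_monomial v).

Lemma old_monomial_le (u v : 'X_{1..M}) : (u <= v)%MM -> (old_monomial u <= old_monomial v)%MM.
Proof. by move=> /mnm_lepP uv; apply/mnm_lepP => k; rewrite !mnmE. Qed.

(** If deleting the last variables of v does not leave a color-squarefree monomial,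
    then v is divisible by two old variables of one color, possibly equal. *)
Lemma nonstandard_initial v : ~ U (old_monomial v) -> initial_ideal phiI 'X_[v].
Proof.
move=> nU.
suff [g [u [Ig gu uv]]] : exists g u, [/\ phiI g, is_initial_monomial g u & (u <= v)%MM].
  rewrite -(submK uv) mpolyXD; apply: ideal_genM; apply: ideal_gen_incl.
  by exists g, u.
have [/existsP[i /existsP[j /existsP[l jl]]]|none] := boolP [exists i, exists j : 'I_(m i),
    exists l : 'I_(m i), (U_(vtx (old j)) + U_(vtx (old l)) <= v)%MM].
  have [g Ig gu] := same_color_initial j l.
  by exists g, (U_(vtx (old j)) + U_(vtx (old l)))%MM.
have {}none i (j l : 'I_(m i)) : ~~ (U_(vtx (old j)) + U_(vtx (old l)) <= v)%MM.
  apply: contra none => jl; apply/existsP; exists i.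
  by apply/existsP; exists j; apply/existsP; exists l.
have csf : color_squarefree (old_monomial v).
  split.
    elim/vtx_ind => i j; rewrite old_monomialE leqNgt; apply: contra (none i j j) => vj.
    apply/mnm_lepP => k; rewrite mnmDE !mnm1E.
    by case: eqP => // <-; rewrite addn1.
  move=> i j l; rewrite !old_monomialE => vj vl; apply/eqP.
  apply: contraNT (none i j l) => jl; apply/mnm_lepP => k; rewrite mnmDE !mnm1E.
  have [E|_] := eqVneq (vtx (old j)) k; last by case: eqP => // <-.
  by rewrite -E eq_vtx old_eq eq_sym (negbTE jl).
have [|g Ig gu] := @word_initial (word_of (old_monomial v)); first by rewrite word_ofK.
exists g, (\sum_i word_mon (word_of (old_monomial v) i))%MM; split=> //.
apply/mnm_lepP; elim/vtx_ind => i k; rewrite mnm_sumE (bigD1 i) //= big1 => [|i' ii'].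
  rewrite addn0 /word_mon; case: eqP => [_|]; first by rewrite mnm0E.
  rewrite mnm1E eq_vtx; case: eqP => // <-.
  have vE (j : 'I_(m i)) := word_monomialE (word_of (old_monomial v)) j.
  rewrite word_ofK // in vE.
  by case: (msuccP (word_of _ i)) vE => // j /(_ j); rewrite old_monomialE eqxx => ->.
by rewrite /word_mon; case: ifP; rewrite ?mnm0E // mnm1E neq_vtx.
Qed.

Lemma initial_ideal_nonstandard f : initial_ideal phiI f <-> nonstandard f.
Proof.
case: (U_ideal) => _ Udiv _ _; split.
  apply: ideal_gen_ind => [v|g h gP hP v|h _ [g [u [Ig gu ->]]] v].
  - by rewrite msupp0.
  - by move/msuppD_le; rewrite mem_cat => /orP[/gP|/hP].
  move/msuppM_le => /allpairsP[[a b] /= [_]]; rewrite msuppX inE => /eqP -> ->.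
  move=> Uab; apply: (initial_monomial_nonstandard phi_gp U_ideal U_shifted Ig gu).
  by apply: Udiv Uab; apply: old_monomial_le; apply: lem_addl.
move=> fP; rewrite [f]mpolyE big_seq; apply: (big_ind (initial_ideal phiI)).
- exact: ideal_gen0.
- exact: ideal_genD.
- by move=> v /fP nU; rewrite -mul_mpolyC; apply: ideal_genM; apply: nonstandard_initial.
Qed.

End Lower.

(** * The multigraded generic initial ideal *)

Section Gin.
Variable K : fieldType.
Hypothesis infinite_K : forall s : seq K, exists x : K, x \notin s.

(** Multiply p by the determinant before choosing a point. *)
Lemma nonvanishing_unitmx k (p : {mpoly K[k * k]}) : p != 0 ->
  exists2 A : 'M[K]_k, A \in unitmx & p.@[fun l => mxvec A 0 l] != 0.
Proof.
move=> p0; have det_eval (A : 'M[K]_k) :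
    (\det (generic_mx K k)).@[fun l => mxvec A 0 l] = \det A.
  by rewrite -det_map_mx meval_generic_mx.
have det0 : \det (generic_mx K k) != 0.
  by apply: (@meval_neq0 _ _ _ (fun l => mxvec 1%:M 0 l)); rewrite det_eval det1 oner_neq0.
have [x] := mpoly_nonroot infinite_K (mulf_neq0 p0 det0).
pose A : 'M[K]_k := vec_mx (\row_l x l).
rewrite (meval_eq (v2 := fun l => mxvec A 0 l)) => [|l]; last by rewrite vec_mxK mxE.
rewrite mevalM mulf_eq0 negb_or det_eval => /andP[pA dA].
by exists A; rewrite // unitmxE unitfE.
Qed.

Lemma zariski_open_meet k (O O' : 'M[K]_k -> Prop) :
  zariski_open O -> zariski_open O' -> (exists A, O A) -> (exists A, O' A) ->
  exists A, O A /\ O' A.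
Proof.
move=> [E OE] [E' OE'] [A /OE[_ [p Ep pA]]] [A' /OE'[_ [p' Ep' pA']]].
have [B uB] := nonvanishing_unitmx (mulf_neq0 (meval_neq0 pA) (meval_neq0 pA')).
rewrite mevalM mulf_eq0 negb_or => /andP[pB pB'].
by exists B; split; [apply/OE | apply/OE']; split=> //; [exists p | exists p'].
Qed.

(** Both descriptions apply to a matrix family chosen in the intersection of the two
    open sets, which is nonempty color by color. *)
Lemma is_gin_unique d (n : 'I_d -> nat) (I J J' : {mpoly K[nvars n]} -> Prop) :
  is_gin I J -> is_gin I J' -> forall f, J f <-> J' f.
Proof.
move=> [O [Oopen O0 OJ]] [O' [O'open O'0 O'J']] f.
have /fin_all_exists[phi phiP] i : exists A : 'M[K]_(n i), O i A /\ O' i A.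
  exact: zariski_open_meet.
have <- := OJ phi (fun i => proj1 (phiP i)) f.
exact: O'J' (fun i => proj2 (phiP i)) f.
Qed.

Variables (d : nat) (m : 'I_d -> nat) (U : 'X_{1..nvars m} -> Prop).
Hypothesis U_ideal : color_squarefree_order_ideal U.
Hypothesis U_shifted : color_squarefree_shifted U.
Local Notation I := (stanley_reisner K (balanced_squeezed U)).
Local Notation M := (nvars (msucc m)).
Local Notation last i := (@ord_max (m i) : 'I_(msucc m i)).
Local Notation old j := (widen_ord (leqnSn _) j : 'I_(msucc m _)).

Lemma is_gin_nonstandard : is_gin I (@nonstandard K d m U).
Proof.
exists (fun i (A : 'M[K]_(msucc m i)) => A \in unitmx /\ @position_form K (m i) A != 0).
split=> [i|i|phi phiO f].
- exists (eq (position_poly K (m i))) => A; split=> [[uA gA]|[uA [_ <- gA]]].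
    by split=> //; exists (position_poly K (m i)); rewrite // meval_position_poly.
  by rewrite meval_position_poly in gA.
- have [A uA pA] := nonvanishing_unitmx (position_poly_neq0 K (m i)).
  by exists A; split; rewrite // -meval_position_poly.
- apply: initial_ideal_nonstandard => // i.
  by have [uA gA] := phiO i; apply: position_form_general_position.
Qed.

Lemma gin_nonstandard f : gin I f <-> nonstandard U f.
Proof.
apply: is_gin_unique is_gin_nonstandard _.
by apply: epsilon_spec; exists (@nonstandard K d m U); apply: is_gin_nonstandard.
Qed.

End Gin.

(** * Colored polarization *)

Section ColorWord.
Variables (d : nat) (n : 'I_d -> nat).

Lemma count_color_word (u : 'X_{1..nvars n}) i (j : 'I_(n i)) :
  count_mem (j : nat) (color_word u i) = u (vtx j).
Proof.
rewrite /color_word count_flatten -map_comp sumnE big_map big_enum /=.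
rewrite (bigD1 j) //= big1 => [|l lj]; rewrite count_nseq /= ?eqxx ?mul1n ?addn0 //.
by rewrite val_eqE (negbTE lj).
Qed.

Lemma color_word_lt (u : 'X_{1..nvars n}) i t : t \in color_word u i -> (t < n i)%N.
Proof. by move=> /flatten_mapP[j _]; rewrite mem_nseq => /andP[_ /eqP ->]. Qed.

Lemma color_word_mem (u : 'X_{1..nvars n}) i (j : 'I_(n i)) :
  ((j : nat) \in color_word u i) = (0 < u (vtx j))%N.
Proof. by rewrite -count_color_word -has_count has_pred1. Qed.

Lemma color_word_sorted (u : 'X_{1..nvars n}) i : sorted leq (color_word u i).
Proof.
rewrite (sorted_pairwise leq_trans) /color_word.
have : pairwise ltn [seq val j | j <- enum 'I_(n i)].
  by rewrite val_enum_ord -(sorted_pairwise ltn_trans) iota_ltn_sorted.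
elim: (enum _) => //= j s IH /andP[js /IH sorted_s].
rewrite pairwise_cat sorted_s andbT; apply/andP; split.
  apply/allrelP => a b; rewrite mem_nseq => /andP[_ /eqP ->] /flatten_mapP[l ls].
  rewrite mem_nseq => /andP[_ /eqP ->].
  by apply: ltnW; apply: (allP js); apply: map_f.
elim: (u (vtx j)) => //= k ->; rewrite andbT; apply/allP => b.
by rewrite mem_nseq => /andP[_ /eqP ->].
Qed.

(** A color word is the sorted list of its letters, hence determined by their
    multiplicities. *)
Lemma color_wordP (u : 'X_{1..nvars n}) i (s : seq nat) :
  sorted leq s -> {in s, forall t, (t < n i)%N} ->
  (forall j : 'I_(n i), u (vtx j) = count_mem (j : nat) s) -> color_word u i = s.
Proof.
move=> ss sn us; apply: (sorted_eq leq_trans anti_leq) => //; first exact: color_word_sorted.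
apply/allP => t _ /=; have [tn|nt] := ltnP t (n i).
  by rewrite (count_color_word u (Ordinal tn)) us.
have ns r : {in r, forall t, (t < n i)%N} -> count_mem t r = 0%N.
  by move=> rn; apply/count_memPn; apply/negP => /rn; rewrite ltnNge nt.
by rewrite !ns // => a; apply: color_word_lt.
Qed.

Lemma color_word_inj (u v : 'X_{1..nvars n}) :
  (forall i, color_word u i = color_word v i) -> u = v.
Proof.
by move=> uv; apply/mnmP; elim/vtx_ind => i j; rewrite -!count_color_word uv.
Qed.

(** With at most one variable of each color there is nothing to spread out. *)
Lemma polarization_small (u v : 'X_{1..nvars n}) :
  (forall i, (size (color_word u i) <= 1)%N) -> is_colored_polarization u v -> v = u.
Proof.
move=> u1 uv; apply: color_word_inj => i; rewrite uv.
by case: (color_word u i) (u1 i) => [|a [|]] //= _; rewrite /mkseq /= addn0.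
Qed.

Lemma polarization_refl (u : 'X_{1..nvars n}) :
  (forall i, (size (color_word u i) <= 1)%N) -> is_colored_polarization u u.
Proof.
by move=> u1 i; case: (color_word u i) (u1 i) => [|a [|]] //= _; rewrite /mkseq /= addn0.
Qed.

(** The second letter is raised by one and so becomes different from the first. *)
Lemma polarization_spread (u v : 'X_{1..nvars n}) i :
  is_colored_polarization u v -> (1 < size (color_word u i))%N ->
  exists a b : 'I_(n i), [/\ a != b, (0 < v (vtx a))%N & (0 < v (vtx b))%N].
Proof.
move=> uv; case E: (color_word u i) (color_word_sorted u i) => [|a [|b s]] //=.
case/andP=> ab _ _; have := uv i; rewrite E /mkseq /= addn0 addn1 => vE.
have av : a \in color_word v i by rewrite vE inE eqxx.
have bv : b.+1 \in color_word v i by rewrite vE !inE eqxx orbT.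
exists (Ordinal (color_word_lt av)), (Ordinal (color_word_lt bv)).
by rewrite -!color_word_mem av bv -val_eqE /= ltn_eqF.
Qed.

Lemma polarization_pair i (a b c : 'I_(n i)) : (a <= c)%N -> b = c.+1 :> nat ->
  is_colored_polarization (U_(vtx a) + U_(vtx c))%MM (U_(vtx a) + U_(vtx b))%MM.
Proof.
move=> ac bc i'.
have word2 (x y : 'I_(n i)) : (x <= y)%N ->
    color_word (U_(vtx x) + U_(vtx y))%MM i = [:: (x : nat); (y : nat)].
  move=> xy; apply: color_wordP => [|t|j] /=; first by rewrite xy.
    by rewrite !inE => /orP[] /eqP ->.
  by rewrite mnmDE !mnm1E !eq_vtx addn0.
have word0 (x y : 'I_(n i)) : i != i' -> color_word (U_(vtx x) + U_(vtx y))%MM i' = [::].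
  by move=> ii'; apply: color_wordP => // j; rewrite mnmDE !mnm1E !neq_vtx.
have [E|ii'] := eqVneq i i'; last by rewrite !word0.
by case: _ / E; rewrite !word2 /mkseq //= ?addn0 ?addn1 ?bc // ltnW // ltnS.
Qed.

Lemma size_color_word (u : 'X_{1..nvars n}) i :
  size (color_word u i) = (\sum_(j < n i) u (vtx j))%N.
Proof.
rewrite size_flatten /shape -map_comp sumnE big_map big_enum /=.
by apply: eq_bigr => j _; rewrite size_nseq.
Qed.

End ColorWord.

Lemma sum_varE N (G : {set 'I_N}) k : (\sum_(l in G) U_(l))%MM k = (k \in G) :> nat.
Proof.
rewrite mnm_sumE; have [kG|kG] := boolP (k \in G).
  by rewrite (bigD1 k) //= mnm1E eqxx big1 // => l /andP[_ /negbTE lk]; rewrite mnm1E lk.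
by apply: big1 => l lG; rewrite mnm1E; case: eqP => // E; rewrite -E lG in kG.
Qed.

(** * The color-shifted complex *)

Lemma lem_mdeg_eq N (u v : 'X_{1..N}) : (v <= u)%MM -> (mdeg u <= mdeg v)%N -> v = u.
Proof.
move=> vu; rewrite -(submK vu) mdegD -[leqRHS]add0n leq_add2r leqn0 mdeg_eq0 => /eqP ->.
by rewrite add0m.
Qed.

(** Divisibility of monomials is well founded. *)
Lemma ex_minimal_monomial N (P : 'X_{1..N} -> Prop) u : P u ->
  exists v, [/\ (v <= u)%MM, P v & forall v', (v' <= v)%MM -> P v' -> v' = v].
Proof.
have [k] := ubnP (mdeg u); elim: k u => // k IH u uk Pu.
have [umin|] := excluded_middle_informative (forall v', (v' <= u)%MM -> P v' -> v' = u).
  by exists u; split=> //; apply: lepm_refl.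
move=> notmin.
have [[v' [v'u Pv' ne]]|none] :=
    excluded_middle_informative (exists v', [/\ (v' <= u)%MM, P v' & v' != u]); last first.
  case: notmin => v' v'u Pv'; apply/eqP/negPn/negP => ne.
  by apply: none; exists v'.
have [|v [vv' Pv vmin]] := IH v' _ Pv'.
  rewrite -ltnS; apply: leq_trans uk; rewrite ltnS ltnNge.
  by apply: contra ne => uv'; rewrite (lem_mdeg_eq v'u uv').
by exists v; split=> //; apply: lepm_trans vv' v'u.
Qed.

Section Shift.
Variable K : fieldType.
Hypothesis infinite_K : forall s : seq K, exists x : K, x \notin s.
Variables (d : nat) (m : 'I_d -> nat) (U : 'X_{1..nvars m} -> Prop).
Hypothesis U_ideal : color_squarefree_order_ideal U.
Hypothesis U_shifted : color_squarefree_shifted U.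
Local Notation Delta := (balanced_squeezed U).
Local Notation M := (nvars (msucc m)).
Local Notation last i := (@ord_max (m i) : 'I_(msucc m i)).
Local Notation old j := (widen_ord (leqnSn _) j : 'I_(msucc m _)).

Lemma gin_monomial (u : 'X_{1..M}) :
  gin (stanley_reisner K Delta) 'X_[u] <-> ~ U (old_monomial u).
Proof.
rewrite gin_nonstandard //; split=> [|nU v].
  by apply; rewrite msuppX inE.
by rewrite msuppX inE => /eqP ->.
Qed.

Lemma color_shifted_ideal_monomial (Gamma : {set 'I_M} -> Prop) (g : 'X_{1..M}) :
  @color_shifted_ideal K d (msucc m) Gamma 'X_[g] ->
  exists u v, [/\ minimal_monomial_generator (gin (stanley_reisner K Gamma)) u,
                  is_colored_polarization u v & (v <= g)%MM].
Proof.
suff H f : @color_shifted_ideal K d (msucc m) Gamma f -> forall g, g \in msupp f ->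
  exists u v, [/\ minimal_monomial_generator (gin (stanley_reisner K Gamma)) u,
                  is_colored_polarization u v & (v <= g)%MM].
  by move/H; apply; rewrite msuppX inE.
move: f; apply: ideal_gen_ind => [h|f1 f2 H1 H2 h|h _ [u [v [umin uv ->]]] w].
- by rewrite msupp0.
- by move/msuppD_le; rewrite mem_cat => /orP[/H1|/H2].
move/msuppM_le => /allpairsP[[a b] /= [_]]; rewrite msuppX inE => /eqP -> ->.
by exists u, v; split=> //; apply: lem_addl.
Qed.

Lemma mdeg_old_monomial (u : 'X_{1..M}) : (mdeg (old_monomial u) <= mdeg u)%N.
Proof.
rewrite !mdegE !big_vtx; apply: leq_sum => i _.
rewrite [leqRHS]big_ord_recr /=.
by under eq_bigr => j _ do rewrite old_monomialE; apply: leq_addr.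
Qed.

(** U contains 1 and all variables. *)
Lemma nonstandard_mdeg u : ~ U (old_monomial u) -> (1 < mdeg u)%N.
Proof.
case: U_ideal => _ _ U0 U1 nU; rewrite ltnNge; apply/negP => u1; apply: nU.
have := leq_trans (mdeg_old_monomial u) u1; rewrite leq_eqVlt ltnS leqn0 mdeg_eq0.
by case/orP => [/mdeg1P[k /eqP ->]|/eqP ->].
Qed.

(** Let v be the polarization of a generator u of gin(I_Delta), and suppose v divides a
    face. If u has two variables of one color, so has v, but a face has no two vertices
    of one color; otherwise v = u, and its old part divides an element of U.
    Conversely let G be a nonface. If G has vertices a < b of one color, use the
    generator x_a x_(b-1), whose polarization is x_a x_b. Otherwise the monomial of G
    is nonstandard, and a minimal nonstandard divisor is a generator fixed by polarization. *)
Lemma color_shift_squeezed (G : {set 'I_M}) : color_shift K Delta G <-> Delta G.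
Proof.
case: (U_ideal) => Ucsf Udiv _ _; rewrite /color_shift mprodXE; split; last first.
  move=> /(balanced_squeezedP U_ideal)[w Uw wG].
  move=> /color_shifted_ideal_monomial[u [v [[/gin_monomial nU _] uv vG]]].
  have {}vG k : (v k <= (k \in G))%N by rewrite -sum_varE; apply: (mnm_lepP vG).
  have u1 i : (size (color_word u i) <= 1)%N.
    rewrite leqNgt; apply/negP => /(polarization_spread uv)[a [b [ab va vb]]].
    have aG : vtx a \in G by have := leq_trans va (vG _); rewrite lt0b.
    have bG : vtx b \in G by have := leq_trans vb (vG _); rewrite lt0b.
    by rewrite (wG i a aG) (wG i b bG) eqxx in ab.
  rewrite (polarization_small u1 uv) in vG; apply: nU; apply: Udiv Uw.
  apply/mnm_lepP; elim/vtx_ind => i j; rewrite old_monomialE word_monomialE.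
  apply: leq_trans (vG _) _; case: (boolP (vtx (old j) \in G)) => // /wG ->.
  by rewrite eqxx.
move=> nCSI; have [//|nD] := excluded_middle_informative (Delta G); case: nCSI.
suff [u [v [nU umin uv vG]]] : exists u v : 'X_{1..M}, [/\ ~ U (old_monomial u),
    forall u', (u' <= u)%MM -> ~ U (old_monomial u') -> u' = u,
    is_colored_polarization u v & (v <= \sum_(k in G) U_(k))%MM].
  rewrite -(submK vG) mpolyXD; apply: ideal_genM; apply: ideal_gen_incl.
  exists u, v; split=> //; split; first exact/gin_monomial.
  by move=> u' u'u /gin_monomial; apply: umin.
have [/existsP[i /existsP[a /existsP[b /and3P[ab aG bG]]]]|none] :=
  boolP [exists i, exists a : 'I_(msucc m i), exists b : 'I_(msucc m i),
           [&& (a < b)%N, vtx a \in G & vtx b \in G]].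
  have b0 : (0 < b)%N by apply: leq_ltn_trans ab.
  have cm : (b.-1 < m i)%N by rewrite -ltnS prednK.
  pose c := Ordinal cm; have am : (a < m i)%N by rewrite (leq_trans ab) // -ltnS.
  have aE : a = old (Ordinal am) by apply: val_inj.
  pose u : 'X_{1..M} := (U_(vtx a) + U_(vtx (old c)))%MM.
  have nU : ~ U (old_monomial u).
    move=> /Ucsf[u1 uc]; have : c = Ordinal am.
      by apply: uc; rewrite old_monomialE mnmDE !mnm1E -?aE eqxx // addn1.
    move=> ca; have := u1 (vtx c); rewrite old_monomialE ca mnmDE !mnm1E.
    by rewrite -aE ca -aE eqxx.
  exists u, (U_(vtx a) + U_(vtx b))%MM; split=> //.
  - move=> u' u'u /nonstandard_mdeg u'2; apply: lem_mdeg_eq => //.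
    by rewrite mdegD !mdeg1.
  - apply: polarization_pair => /=; last by rewrite prednK.
    by rewrite -ltnS prednK.
  - apply/mnm_lepP => k; rewrite sum_varE mnmDE !mnm1E.
    have [<-|_] := eqVneq (vtx a) k; last by case: eqP => // <-; rewrite bG.
    by rewrite aG eq_vtx -val_eqE /= gtn_eqF.
have {}none i (a b : 'I_(msucc m i)) : vtx a \in G -> vtx b \in G -> a = b.
  move=> aG bG; have [ab|ba|/val_inj //] := ltngtP a b; case/negP: none.
    by apply/existsP; exists i; apply/existsP; exists a; apply/existsP; exists b; rewrite ab aG.
  by apply/existsP; exists i; apply/existsP; exists b; apply/existsP; exists a; rewrite ba aG bG.
pose g : 'X_{1..M} := (\sum_(k in G) U_(k))%MM.
have gE k : g k = (k \in G) by apply: sum_varE.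
(* Otherwise G is contained in the facet of its old part: where G has no old vertex,
   the facet has the last one. *)
have nU : ~ U (old_monomial g).
  move=> Ug; apply: nD; apply/(balanced_squeezedP U_ideal).
  have csf := Ucsf _ Ug; exists (word_of (old_monomial g)); first by rewrite word_ofK.
  have wE i (j : 'I_(m i)) := word_monomialE (word_of (old_monomial g)) j.
  rewrite word_ofK // in wE => i k kG; have {}wE j := wE i j.
  case: (msuccP (word_of _ i)) wE => [j|] wE.
    apply: none => //; have := wE j; rewrite eqxx old_monomialE gE.
    by case: (_ \in _).
  case: (msuccP k) kG => // j jG.
  by have := wE j; rewrite last_old old_monomialE gE jG.
have [u [ug nUu umin]] := ex_minimal_monomial (P := fun u => ~ U (old_monomial u)) nU.
exists u, u; split=> //; apply: polarization_refl => i.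
rewrite size_color_word (leq_trans (n := \sum_(j < msucc m i) (vtx j \in G))) //.
  by apply: leq_sum => j _; rewrite -gE; apply: (mnm_lepP ug).
rewrite -big_mkcond /= sum1_card; apply/card_le1_eqP => a b.
by move=> aG bG; apply: none.
Qed.

End Shift.

Theorem theorem5p14 (K : fieldType)
    (infinite_K : forall s : seq K, exists x : K, x \notin s)
    (d : nat) (d_ge1 : (1 <= d)%N) (m : 'I_d -> nat)
    (U : 'X_{1..nvars m} -> Prop)
    (U_ideal : color_squarefree_order_ideal U)
    (U_shifted : color_squarefree_shifted U) :
  forall p j : nat,
    graded_betti (stanley_reisner K (balanced_squeezed U)) p j
    = graded_betti (stanley_reisner K (color_shift K (balanced_squeezed U))) p j.
Proof.
move=> p j; congr (graded_betti (stanley_reisner K _) p j).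
apply: functional_extensionality => G; apply: propositional_extensionality.
by rewrite color_shift_squeezed.
Qed.
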